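(* Let $q=2^h\geq 8$ and let $\mathcal{A}$ be an elation KM-arc of type $q/4$ in $\mathrm{PG}(2,q)$. Then there is a $\beta\in\mathbb{F}_q\setminus\{0,1\}$ such that $\mathcal{A}$ is $\mathrm{PGL}(3,q)$-equivalent to the KM-arc $\mathcal{A}_{1/\beta^2,\beta,0,0}$. Hence, $\mathcal{A}$ is a translation KM-arc.
   Context: A KM-arc of type $t$ in $\mathrm{PG}(2,q)$ is a set of $q+t$ points such that every line meets it in $0$, $2$ or $t$ points (each of these values occurring); a line meeting it in $i$ points is an $i$-secant. A KM-arc of type $2$ is a hyperoval. If $2<t<q$, then $q$ is even, $t\mid q$ and all $t$-secants pass through one common point, the $t$-nucleus. An elation with axis a line $\ell$ and centre a point $R\in\ell$ is a collineation fixing all points of $\ell$ and stabilising all lines through $R$ (the identity is included). A KM-arc $\mathcal{A}$ of type $t>2$ is an elation KM-arc with elation line $\ell_\infty$ if for every $t$-secant $\ell\neq\ell_\infty$ the group of elations with axis $\ell_\infty$ stabilising $\mathcal{A}$ is transitive on the points of $\mathcal{A}\cap\ell$ (any point of $\mathcal{A}\cap\ell$ can be mapped to any other one by an element of the group). A hyperoval (KM-arc of type $2$) is an elation KM-arc (elation hyperoval) with elation line $\ell_\infty$ if it is stabilised by a non-trivial elation with axis $\ell_\infty$. A KM-arc $\mathcal{A}$ is a translation KM-arc with translation line $\ell_\infty$ if the group of all elations with axis $\ell_\infty$ stabilising $\mathcal{A}$ acts transitively on the points of $\mathcal{A}\setminus\ell_\infty$; it is a translation KM-arc if this holds for some line $\ell_\infty$.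 The KM-arcs $\mathcal{A}_{\alpha,\beta,a,b}$: let $\mathrm{Tr}$ be the absolute trace $\mathbb{F}_q\to\mathbb{F}_2$. For $\alpha,\beta\in\mathbb{F}_q\setminus\{0,1\}$ with $\alpha\beta\neq1$ and $a,b\in\mathbb{F}_2$, put $\gamma=\frac{\beta+1}{\alpha\beta+1}$, $\xi=\alpha\beta\gamma$, and $\mathcal{S}_0=\{(0,1,z)\mid \mathrm{Tr}(z)=0,\ \mathrm{Tr}(z/\alpha)=a\}$, $\mathcal{S}_1=\{(1,0,z)\mid \mathrm{Tr}(z)=0,\ \mathrm{Tr}(z/(\alpha\gamma))=0\}$, $\mathcal{S}_2=\{(1,1,z)\mid \mathrm{Tr}(z)=1,\ \mathrm{Tr}(z/(\alpha\beta))=b\}$, $\mathcal{S}_3=\{(1,\gamma,z)\mid \mathrm{Tr}(z/(\alpha\gamma))=a+1,\ \mathrm{Tr}(z/\xi)=b+1\}$, $\mathcal{S}_4=\{(1,\beta+1,z)\mid \mathrm{Tr}(z/(\alpha\beta))=a+b+1,\ \mathrm{Tr}(z/\xi)=b\}$, where $z$ ranges over $\mathbb{F}_q$. Then $\mathcal{A}_{\alpha,\beta,a,b}=\bigcup_{i=0}^4\mathcal{S}_i$, which is known to be a KM-arc of type $q/4$ in $\mathrm{PG}(2,q)$. *)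

(* Defs.v *)
From HB Require Import structures.
From mathcomp Require Import all_boot all_order all_algebra all_fingroup all_field.

Set Implicit Arguments.
Unset Strict Implicit.
Unset Printing Implicit Defensive.

Import GRing.Theory.
Local Open Scope ring_scope.

(* A k-dimensional subspace of F^3 is represented by the canonical square
   matrix <<U>>%MS whose row space it is, so that Leibniz equality is equality
   of subspaces and the subspaces form a finType. *)
Definition is_subsp (F : finFieldType) (k : nat) (U : 'M[F]_3) : bool :=
  (<<U>>%MS == U) && (\rank U == k).

Notation point F := {U : 'M[F]_3 | is_subsp 1 U}.
Notation line F := {U : 'M[F]_3 | is_subsp 2 U}.

Section PG2.
Variable F : finFieldType.
Implicit Types (A B : {set point F}) (P Q R : point F) (l m : line F).
Implicit Types (s : {perm point F}) (t : nat).

Definition points_on l : {set point F} := [set P : point F | (val P <= val l)%MS].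

Definition km_arc t A : Prop :=
  [/\ #|A| = (#|F| + t)%N,
      forall l, #|A :&: points_on l| \in [:: 0%N; 2%N; t]
    & forall i, i \in [:: 0%N; 2%N; t] -> exists l, #|A :&: points_on l| = i].

Definition collineation s : bool :=
  [forall l, exists m, s @: points_on l == points_on m].

Definition elation l R s : bool :=
  [&& R \in points_on l, collineation s,
      [forall P in points_on l, s P == P]
    & [forall m, (R \in points_on m) ==> (s @: points_on m == points_on m)]].

(* The centre ranges over all points of the axis l, so this set is the group
   of all elations with axis l that stabilise A. *)
Definition elations_stab l A : {set {perm point F}} :=
  [set s | [exists R, elation l R s] & s @: A == A].

Definition elation_km_arc_line t A l : Prop :=
  [/\ km_arc t A,
      (2 < t)%N -> forall m, #|A :&: points_on m| = t -> m != l ->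
        {in A :&: points_on m &, forall P Q,
           exists2 s, s \in elations_stab l A & s P = Q}
    & t = 2%N -> exists2 s, s \in elations_stab l A & s != 1%g].

Definition elation_km_arc t A : Prop := exists l, elation_km_arc_line t A l.

Definition translation_km_arc_line t A l : Prop :=
  km_arc t A /\
  {in A :\: points_on l &, forall P Q,
     exists2 s, s \in elations_stab l A & s P = Q}.

Definition translation_km_arc t A : Prop :=
  exists l, translation_km_arc_line t A l.

(* PGL(3,q) as a set of permutations of the points; matrices act on row
   vectors from the right. *)
Definition PGL3 : {set {perm point F}} :=
  [set s : {perm point F} | [exists M : 'M[F]_3,
     (M \in unitmx) && [forall P, (val (s P) == val P *m M)%MS]]].

Definition PGL3_equivalent A B : Prop := exists2 s, s \in PGL3 & s @: A = B.

(* The absolute trace of F of order 2 ^ h, with its values 0 and 1 in the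
   prime subfield of F; ofF2 is the inclusion of 'F_2 into F. *)
Definition Tr (z : F) : F := \sum_(i < logn 2 #|F|) z ^+ (2 ^ i).
Definition ofF2 (c : 'F_2) : F := (c : nat)%:R.

Definition vec3 (x y z : F) : 'rV[F]_3 := \row_j [:: x; y; z]`_j.

Definition trace_points (x y u v : F) (c d : 'F_2) : {set point F} :=
  [set P : point F | [exists z : F,
     [&& (val P == vec3 x y z)%MS, Tr (z / u) == ofF2 c & Tr (z / v) == ofF2 d]]].

Section Arc.
Variables (alpha beta : F) (a b : 'F_2).
Let gamma := (beta + 1) / (alpha * beta + 1).
Let xi := alpha * beta * gamma.

Definition km_arc_family : {set point F} :=
  trace_points 0 1 1 alpha 0 a
  :|: trace_points 1 0 1 (alpha * gamma) 0 0
  :|: trace_points 1 1 1 (alpha * beta) 1 b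
  :|: trace_points 1 gamma (alpha * gamma) xi (a + 1) (b + 1)
  :|: trace_points 1 (beta + 1) (alpha * beta) xi (a + b + 1) b.

End Arc.
End PG2.

Lemma Tr_F2 (F : finFieldType) (h : nat) (z : F) :
  #|F| = (2 ^ h)%N -> Tr z \in [:: 0; 1].
Proof.
move=> cardF; have ch2 := card_finPcharP cardF isT.
have TrE : Tr z = \sum_(i < h) z ^+ (2 ^ i) by rewrite /Tr cardF pfactorK.
have Tr2 : Tr z ^+ 2 = Tr z.
  rewrite TrE -(pFrobenius_autE ch2) rmorph_sum /=.
  under eq_bigr => i _ do rewrite pFrobenius_autE -exprM -expnSr.
  case: h cardF {TrE} => [|h] cardF; first by rewrite !big_ord0.
  by rewrite big_ord_recr big_ord_recl /= -cardF expf_card addrC.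
have : Tr z * (Tr z - 1) = 0 by rewrite mulrBr mulr1 -expr2 Tr2 subrr.
by move/eqP; rewrite mulf_eq0 subr_eq0 !inE.
Qed.

(* Main.v *)
Require Import Defs.
From HB Require Import structures.
From mathcomp Require Import all_boot all_order all_algebra all_fingroup all_field.
From mathcomp Require Import ring zify.
Import GRing.Theory.
Local Open Scope ring_scope.

Set Implicit Arguments.
Unset Strict Implicit.
Unset Printing Implicit Defensive.

(** Choose affine coordinates in which the elation line is at infinity and the
    t-nucleus N is the vertical direction.  A pencil count at a point of the arc
    shows that no two t-secants meet in a point of the arc, so that the elations
    stabilising the arc and having centre N form a group H of vertical
    translations with |H| = t = q/4, and the affine part of the arc is
    {(x, z) | x in X, z in c(x) + H} with |X| >= 4.  (When q = 8 the group H
    consists of the given elation and the identity.)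

    By duality with respect to the trace, H is the common kernel of z -> Tr(w z)
    for w in a group W of order 4.  No three points of the arc on the vertical
    lines x, y, z are collinear if and only if u x + v y + w z = 0 and
    Tr(u c(x) + v c(y) + w c(z)) = 1 for an arrangement u, v, w of W \ {0}.  For
    four elements of X these arrangements form a Latin square (unless W is a
    multiple of F_4, which is treated apart); it must be symmetric, and X is an
    affine image of W.  A fifth element of X would be the sum of any three of
    these four, so |X| = 4.  The trace conditions now determine c modulo H up to
    a shear and a scaling, and after these the affine part of the arc is the graph
    {(u, v) | u = Tr v + (b + 1) Tr(b v)} of an additive function.  It is
    therefore invariant under a transitive group of translations, and it
    determines the points at infinity of the arc. *)

(** * Arithmetic in characteristic 2 *)

Section Characteristic2.
Variable F : finFieldType.
Hypothesis ch2 : 2 \in [pchar F].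
Implicit Types x y z : F.

Lemma pchar2_2 : 2%:R = 0 :> F.
Proof. exact: pcharf0. Qed.

Lemma pchar2_3 : 3%:R = 1 :> F.
Proof. by rewrite -[3%N]/(1 + 2)%N natrD pchar2_2 addr0. Qed.

Lemma pchar2_4 : 4%:R = 0 :> F.
Proof. by rewrite -[4%N]/(2 + 2)%N natrD pchar2_2 addr0. Qed.

Lemma pchar2_6 : 6%:R = 0 :> F.
Proof. by rewrite -[6%N]/(4 + 2)%N natrD pchar2_2 pchar2_4 addr0. Qed.

Lemma opp_pchar2 x : - x = x.
Proof. by apply/eqP; rewrite eq_sym -addr_eq0; apply/eqP; ring: pchar2_2. Qed.

Lemma addxx x : x + x = 0.
Proof. by ring: pchar2_2. Qed.

Lemma addKx x y : x + (x + y) = y.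
Proof. by rewrite addrA addxx add0r. Qed.

Lemma addxK x y : x + y + y = x.
Proof. by rewrite -addrA addxx addr0. Qed.

Lemma addx_eq0 x y : (x + y == 0) = (x == y).
Proof. by rewrite addr_eq0 opp_pchar2. Qed.

End Characteristic2.

(* [ring] does not reduce coefficients modulo 2 by itself; it is given the
   reductions of those that occur. *)
Ltac ring2 ch := rewrite ?(opp_pchar2 ch);
  ring: (pchar2_2 ch) (pchar2_3 ch) (pchar2_4 ch) (pchar2_6 ch).

(** * Duality with respect to the trace *)

Section Trace.
Variables (F : finFieldType) (h : nat).
Hypothesis cardF : #|F| = (2 ^ h)%N.
Let ch2 : 2 \in [pchar F] := card_finPcharP cardF isT.
Implicit Types (x y z w : F) (H K : {set F}).

Lemma TrD x y : Tr (x + y) = Tr x + Tr y.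
Proof.
rewrite /Tr -big_split; apply: eq_bigr => i _.
by rewrite exprDn_pchar // (eq_pnat _ (pcharf_eq ch2)) pnatX pnat_id ?orTb.
Qed.

Lemma Tr0 : Tr (0 : F) = 0.
Proof. by have := TrD 0 0; rewrite addr0 => /eqP; rewrite -addx_eq0 // addKx // => /eqP. Qed.

Lemma Tr01 z : (Tr z == 0) || (Tr z == 1).
Proof. by have := Tr_F2 z cardF; rewrite !inE. Qed.

Lemma Tr_neq0 z : (Tr z != 0) = (Tr z == 1).
Proof. by case/orP: (Tr01 z) => /eqP->; rewrite ?oner_eq0 ?eqxx // eq_sym oner_eq0. Qed.

(** Otherwise the trace polynomial, a sum of the [X^(2^i)] of degree [q/2], would have all [q]
    elements of [F] as roots. *)
Lemma Tr_nontrivial : exists z, Tr z = 1.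
Proof.
suff /existsP[z /eqP Tz] : [exists z : F, Tr z == 1] by exists z.
apply: contraT; rewrite negb_exists => /forallP noz.
case: h cardF => [|k] cF; first by have := finNzRing_gt1 F; rewrite cF.
pose p : {poly F} := \sum_(i < k.+1) 'X^(2 ^ i).
have p_neq0 : p != 0.
  apply/eqP => /(congr1 (coefp (2 ^ k))) /=; rewrite coef0 /p coef_sum.
  rewrite big_ord_recr /= coefXn eqxx big1 ?add0r => [/eqP|i _].
    by rewrite oner_eq0.
  by rewrite coefXn eqn_exp2l // gtn_eqF.
have roots_p : all (root p) (enum F).
  apply/allP => z _; rewrite /root /p horner_sum.
  under eq_bigr do rewrite hornerXn.
  by move: (noz z); rewrite -Tr_neq0 negbK /Tr cF pfactorK.
have := max_poly_roots p_neq0 roots_p (enum_uniq _).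
rewrite -cardE cF => lt_sz.
have : (size p <= (2 ^ k).+1)%N.
  apply: (leq_trans (size_sum _ _ _)); apply/bigmax_leqP => i _.
  by rewrite size_polyXn ltnS leq_exp2l // -ltnS.
move/(leq_trans lt_sz); rewrite ltnS expnS mul2n -addnn -{3}[(2 ^ k)%N]addn0.
by rewrite leq_add2l leqn0 expn_eq0.
Qed.

(** The orthogonal complement of [H] for the trace form [(w, z) -> Tr (w z)]. *)
Definition annihilator H : {set F} :=
  [set w | [forall z in H, Tr (w * z) == 0]].

Lemma annihilatorP H w :
  reflect (forall z, z \in H -> Tr (w * z) = 0) (w \in annihilator H).
Proof.
rewrite inE; apply: (iffP forallP) => wH z; first by move/(implyP (wH z))/eqP.
by apply/implyP => /wH->.
Qed.

Lemma annihilator_addr_closed H : addr_closed (annihilator H).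
Proof.
split=> [|u v /annihilatorP uH /annihilatorP vH]; apply/annihilatorP => z Hz.
  by rewrite mul0r Tr0.
by rewrite mulrDl TrD uH ?vH ?addr0.
Qed.

(** The additive character attached to the trace. Its values are taken in the integers, so that
    character sums can be compared with cardinalities. *)
Let sgn z : int := (-1) ^+ (Tr z != 0).

Let sgnD x y : sgn (x + y) = sgn x * sgn y.
Proof.
rewrite /sgn -signr_addb TrD.
case/orP: (Tr01 x) => /eqP->; case/orP: (Tr01 y) => /eqP->;
  by rewrite ?addr0 ?add0r ?eqxx ?addxx ?oner_eq0 ?eqxx.
Qed.

(** Orthogonality of characters: if some [y] in [H] has [Tr (w y) = 1], translating the summation by
    [y] changes the sign of the sum, which is therefore 0. *)
Let sum_sgn H w : addr_closed H ->
  \sum_(z in H) sgn (w * z) = if w \in annihilator H then #|H|%:Z else 0.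
Proof.
case=> H0 HD; case: ifPn => [/annihilatorP wH|].
  rewrite (eq_bigr (fun=> 1)) => [|z Hz]; last by rewrite /sgn wH ?eqxx.
  by rewrite sumr_const natz.
rewrite inE negb_forall => /existsP[y]; rewrite negb_imply => /andP[Hy wy].
set s := \sum_(z in H) _.
suff: s = - s by move/esym/eqP; rewrite Num.Theory.eqNr => /eqP.
rewrite {1}/s (reindex_inj (addrI y)) -sumrN.
apply: eq_big => [z|z _]; last by rewrite mulrDr sgnD {1}/sgn wy mulN1r.
apply/idP/idP => Hz; last exact: HD.
by rewrite -(addKx ch2 y z); exact: HD.
Qed.

Lemma annihilator_setT : annihilator setT = [set 0].
Proof.
apply/setP => w; rewrite in_set1; apply/annihilatorP/eqP => [wT|-> z _].
  apply/eqP; apply: contraT => w0; have [z Tz] := Tr_nontrivial.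
  have := wT (w^-1 * z) (in_setT _); rewrite mulVKf // Tz => /eqP.
  by rewrite oner_eq0.
by rewrite mul0r Tr0.
Qed.

(** The double sum of [sgn (w z)] over [w] in [F] and [z] in [H] is evaluated in both orders.
    Summing over [w] first leaves only [z = 0], since the annihilator of [F] is trivial. *)
Lemma card_annihilator H :
  addr_closed H -> (#|annihilator H| * #|H|)%N = #|F|.
Proof.
move=> clH; have [H0 _] := clH; apply/eqP; rewrite -(@Num.Theory.eqr_nat int) natrM.
have <- : \sum_w \sum_(z in H) sgn (w * z) = #|annihilator H|%:R * #|H|%:R.
  under eq_bigr do rewrite sum_sgn //.
  by rewrite -big_mkcond /= sumr_const mulr_natl natz.
rewrite exchange_big (bigD1 0) //= [X in X + _](eq_bigr (fun=> 1)); last first.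
  by move=> w _; rewrite mulr0 /sgn Tr0 eqxx.
rewrite sumr_const cardT -cardE [X in _ + X]big1 ?addr0 // => z /andP[_ z0].
have := @sum_sgn setT z; rewrite annihilator_setT in_set1 (negbTE z0) => sum0.
rewrite -[RHS]sum0; first by apply: eq_big => w; rewrite ?inE // mulrC.
by split=> [|u v _ _]; rewrite in_setT.
Qed.

(** One inclusion is symmetry of the trace form; the orders agree by [card_annihilator] applied to
    [H] and to its annihilator. *)
Lemma annihilatorK H : addr_closed H -> annihilator (annihilator H) = H.
Proof.
move=> clH; apply/esym/eqP; rewrite eqEcard; apply/andP; split.
  apply/subsetP => z Hz; apply/annihilatorP => w /annihilatorP wH.
  by rewrite mulrC wH.
have := card_annihilator (annihilator_addr_closed H).
rewrite -(card_annihilator clH) [RHS]mulnC => /eqP.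
rewrite eqn_pmul2r ?card_gt0; first by move/eqP->.
by apply/set0Pn; exists 0; have [] := annihilator_addr_closed H.
Qed.

Lemma annihilator_sep H z : addr_closed H -> z \notin H ->
  exists2 w, w \in annihilator H & Tr (w * z) = 1.
Proof.
move=> clH; rewrite -{1}(annihilatorK clH) inE negb_forall => /existsP[w].
rewrite negb_imply => /andP[wH]; rewrite mulrC Tr_neq0 => /eqP Twz.
by exists w.
Qed.

End Trace.

(** * Non-collinear triples *)

Section Klein.
Variables (F : finFieldType) (h : nat).
Hypothesis cardF : #|F| = (2 ^ h)%N.
Let ch2 : 2 \in [pchar F] := card_finPcharP cardF isT.
Implicit Types (x y z w u v : F) (H : {set F}).

(** With boolean values, sums of traces become exclusive ors and systems of trace conditions can be
    settled by case analysis. *)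
Definition trb z : bool := Tr z != 0.

Lemma trbD x y : trb (x + y) = trb x (+) trb y.
Proof.
rewrite /trb (TrD cardF).
case/orP: (Tr01 cardF x) => /eqP->; case/orP: (Tr01 cardF y) => /eqP->;
  by rewrite ?addr0 ?add0r ?eqxx ?addxx ?oner_eq0 ?eqxx.
Qed.

Lemma trb0 : trb 0 = false.
Proof. by rewrite /trb (Tr0 cardF) eqxx. Qed.

Lemma trbE z : trb z = (Tr z == 1).
Proof. by rewrite -(Tr_neq0 cardF). Qed.

Definition klein w1 w2 : {set F} := [set 0; w1; w2; w1 + w2].

Definition klein_basis w1 w2 := [&& w1 != 0, w2 != 0 & w1 != w2].

Lemma annihilator_klein H : addr_closed H -> #|F| = (4 * #|H|)%N ->
  exists w1 w2, klein_basis w1 w2 /\ annihilator H = klein w1 w2.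
Proof.
move=> clH cFH; have := card_annihilator cardF clH; rewrite cFH => /eqP.
have [W0 WD] := annihilator_addr_closed cardF H.
have H_gt0 : (0 < #|H|)%N by rewrite card_gt0; apply/set0Pn; exists 0; case: clH.
rewrite eqn_pmul2r //; move: (annihilator H) W0 WD => W W0 WD /eqP cW.
have /card_gt0P[w1] : (0 < #|W :\ (0%R : F)|)%N.
  by move: cW; rewrite (cardsD1 (0%R : F)) W0 add1n => -[->].
rewrite !inE => /andP[w1_neq0 W1].
have /card_gt0P[w2] : (0 < #|W :\ (0%R : F) :\ w1|)%N.
  move: cW; rewrite (cardsD1 (0%R : F)) W0 (cardsD1 w1) !inE w1_neq0 W1.
  by rewrite !add1n => -[->].
rewrite !inE => /and3P[w21 w2_neq0 W2].
exists w1, w2; split; first by rewrite /klein_basis w1_neq0 w2_neq0 eq_sym.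
have w3_neq0 : w1 + w2 != 0 by rewrite addx_eq0 // eq_sym.
apply/esym/eqP; rewrite eqEcard cW; apply/andP; split.
  by apply/subsetP => w; rewrite !inE -!orbA => /or4P[] /eqP-> //; apply: WD.
rewrite /klein -!setUA !cardsU1 !inE cards1 !negb_or !(eq_sym 0).
rewrite w1_neq0 w2_neq0 w3_neq0 (eq_sym w1) w21 -!(addx_eq0 ch2 _ (w1 + w2)).
by rewrite addKx // (addrC w1) addKx // w1_neq0 w2_neq0.
Qed.

Lemma memD_klein w1 w2 x y : x \in klein w1 w2 -> y \in klein w1 w2 ->
  x + y \in klein w1 w2.
Proof.
rewrite /klein !inE -!orbA.
by case/or4P => /eqP->; case/or4P => /eqP->; rewrite ?add0r ?addr0 ?addxx //
  ?(addrC w2 w1) ?addKx ?addxK ?addxx // ?(addrC (w1 + w2)) ?addKx //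
   ?(addrC w1 w2) ?addKx ?eqxx ?orbT.
Qed.

(** The two equations say that the weights [u, v, w] at [x, y, z] kill every affine function
    [s x + d]. Being nonzero with sum 0, the weights are distinct in characteristic 2. *)
Definition balanced (W : {set F}) x y z u v w :=
  [/\ [/\ u \in W :\ (0%R : F), v \in W :\ (0%R : F) & w \in W :\ (0%R : F)],
      u + v + w = 0 & u * x + v * y + w * z = 0].

(* No line meets the three cosets [c t + H] on the vertical lines [t = x, y, z]
   iff [z0] below lies outside a subgroup [L]; the functional [Tr (g * _)] that
   separates [z0] from [L] gives the three multipliers. *)
Lemma balanced_of_noncollinear H x y z cx cy cz :
  addr_closed H -> x != y -> x != z -> y != z ->
  (forall s d, [&& s * x + d + cx \in H, s * y + d + cy \in H
                 & s * z + d + cz \in H] -> False) ->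
  exists u v w, balanced (annihilator H) x y z u v w /\
                trb (u * cx + v * cy + w * cz).
Proof.
move=> clH xy xz yz nocol; have [H0 HD] := clH.
pose L := [set p / (x + y) + r / (x + z) | p in H, r in H].
have xy0 : x + y != 0 by rewrite addx_eq0.
have xz0 : x + z != 0 by rewrite addx_eq0.
have clL : addr_closed L.
  split=> [|_ _ /imset2P[p r Hp Hr ->] /imset2P[p' r' Hp' Hr' ->]].
    by apply/imset2P; exists 0 0; rewrite ?mul0r ?addr0.
  apply/imset2P; exists (p + p') (r + r'); rewrite ?HD //; ring.
set z0 := (cx + cy) / (x + y) + (cx + cz) / (x + z).
(* If [z0] were in [L], the slopes computed from [x, y] and from [x, z] would agree, and the line of
   that slope through [(x, cx)] would meet all three cosets. *)
have z0L : z0 \notin L.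
  apply/imset2P => -[p r Hp Hr z0E].
  pose s := (cx + cy + p) / (x + y).
  have sE : s = (cx + cz + r) / (x + z).
    apply/eqP; rewrite -addx_eq0 // /s; apply/eqP.
    transitivity (z0 + (p / (x + y) + r / (x + z))); first by rewrite /z0; ring.
    by rewrite z0E addxx.
  apply: (nocol s (cx + s * x)); apply/and3P; split.
  - suff -> : s * x + (cx + s * x) + cx = 0 by [].
    by ring2 ch2.
  - suff -> : s * y + (cx + s * x) + cy = p by [].
    have -> : s * y + (cx + s * x) + cy = s * (x + y) + (cx + cy) by ring.
    by rewrite /s divfK // -addrA [p + _]addrC addKx.
  - suff -> : s * z + (cx + s * x) + cz = r by [].
    have -> : s * z + (cx + s * x) + cz = s * (x + z) + (cx + cz) by ring.
    by rewrite sE divfK // -addrA [r + _]addrC addKx.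
have [g /annihilatorP gL Tg] := annihilator_sep cardF clL z0L.
have g0 : g != 0.
  by apply: contra_eq_neq Tg => ->; rewrite mul0r (Tr0 cardF) eq_sym oner_eq0.
have W1 : g / (x + y) \in annihilator H.
  apply/annihilatorP => p Hp; rewrite mulrAC -mulrA; apply: gL.
  by apply/imset2P; exists p 0; rewrite ?mul0r ?addr0.
have W2 : g / (x + z) \in annihilator H.
  apply/annihilatorP => p Hp; rewrite mulrAC -mulrA; apply: gL.
  by apply/imset2P; exists 0 p; rewrite ?mul0r ?add0r.
(* The weights are the coefficients of [cx], [cy] and [cz] in [g * z0]. *)
exists (g / (x + y) + g / (x + z)), (g / (x + y)), (g / (x + z)).
split; last first.
  rewrite trbE; apply/eqP; rewrite -Tg; congr Tr.
  by rewrite /z0; ring2 ch2.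
split; first split.
- rewrite in_setD1 addx_eq0 // (inj_eq (mulfI g0)) (inj_eq invr_inj).
  rewrite (inj_eq (addrI x)) yz /=.
  by have [_ WD] := annihilator_addr_closed cardF H; exact: WD.
- by rewrite in_setD1 W1 mulf_neq0 ?invr_neq0.
- by rewrite in_setD1 W2 mulf_neq0 ?invr_neq0.
- by ring2 ch2.
- transitivity (g / (x + y) * (x + y) + g / (x + z) * (x + z)); first by ring.
  by rewrite !divfK // addxx.
Qed.

End Klein.

(** * Four vertical lines *)

Section FourPoints.
Variables (F : finFieldType) (h : nat).
Hypothesis cardF : #|F| = (2 ^ h)%N.
Let ch2 : 2 \in [pchar F] := card_finPcharP cardF isT.
Variables w1 w2 : F.
Hypothesis basis_w : klein_basis w1 w2.
Local Notation W := (klein w1 w2).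
Local Notation W' := (W :\ (0%R : F)).
Implicit Types (x y z w u v : F) (c : F -> F).

Lemma klein_nz w : (w \in W') = [|| w == w1, w == w2 | w == w1 + w2].
Proof.
case/and3P: basis_w => w1_0 w2_0 w12; rewrite !inE -!orbA.
case: eqVneq => [->|//] /=; rewrite ![0 == _]eq_sym (negbTE w1_0) (negbTE w2_0).
by rewrite addx_eq0 // (negbTE w12).
Qed.

Lemma klein_third u v w : u \in W' -> v \in W' -> u != v -> w \in W' ->
  [\/ w = u, w = v | w = u + v].
Proof.
have [T1 T2 T3] : [/\ w1 + w2 + w1 = w2, w1 + w2 + w2 = w1 & w2 + w1 = w1 + w2].
  by split; [rewrite addrC addKx | rewrite addxK | rewrite addrC].
have [T4 T5] : w1 + (w1 + w2) = w2 /\ w2 + (w1 + w2) = w1.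
  by split; rewrite ?addKx // addrC addxK.
rewrite !klein_nz => Wu Wv uv Ww; move: Wu Wv Ww uv.
by do 3![case/or3P=> /eqP->]; rewrite ?eqxx ?(T1, T2, T3, T4, T5) // => _;
  first [by constructor 1 | by constructor 2 | by constructor 3].
Qed.

(** The form is invariant under every change of basis of [W]. Its vanishing, which means that [W] is
    a multiple of [F_4], is thus a property of [W] alone. *)
Lemma quad_klein u v : u \in W' -> v \in W' -> u != v ->
  u ^+ 2 + u * v + v ^+ 2 = w1 ^+ 2 + w1 * w2 + w2 ^+ 2.
Proof.
rewrite !klein_nz.
by do 2![case/or3P=> /eqP->]; rewrite ?eqxx // => _; ring2 ch2.
Qed.

Lemma balanced_swap12 x y z u v w :
  balanced W x y z u v w -> balanced W y x z v u w.
Proof.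
by case=> -[Wu Wv Ww] s1 s2; split=> //; [rewrite -s1 | rewrite -s2]; ring.
Qed.

Lemma balanced_swap23 x y z u v w :
  balanced W x y z u v w -> balanced W x z y u w v.
Proof. by case=> -[Wu Wv Ww] s1 s2; split=> //; [rewrite -s1 | rewrite -s2]; ring. Qed.

Lemma balanced_sum x y z u v w : balanced W x y z u v w -> u = v + w.
Proof.
case=> _ /eqP; rewrite -addrA addx_eq0 // => /eqP-> //.
Qed.

Lemma balanced_neq x y z u v w : balanced W x y z u v w -> v != w.
Proof.
move=> b; have uE := balanced_sum b; case: b => -[]; rewrite uE !in_setD1.
by rewrite addx_eq0 // => /andP[].
Qed.

(** Eliminating [u = v + w] shows that the ratio of the weights at [y] and [z] is dictated by the
    positions [x, y, z]. *)
Lemma balanced_edge x y z u v w : balanced W x y z u v w ->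
  v * (x + y) = w * (x + z).
Proof.
move=> b; have := balanced_sum b; case: b => _ _ + uE; rewrite {}uE => s.
by apply/eqP; rewrite -addx_eq0 // -s; apply/eqP; ring.
Qed.

Lemma sqr_inj_pchar2 x y : x ^+ 2 = y ^+ 2 -> x = y.
Proof.
move/eqP; rewrite -addx_eq0 //; have -> : x ^+ 2 + y ^+ 2 = (x + y) ^+ 2 by ring2 ch2.
by rewrite expf_eq0 /= addx_eq0 // => /eqP.
Qed.

Definition star c x y z u v w :=
  balanced W x y z u v w /\ trb (u * c x + v * c y + w * c z).

Lemma star_swap12 c x y z u v w : star c x y z u v w -> star c y x z v u w.
Proof.
by case=> /balanced_swap12 b t; split=> //; rewrite [v * _ + _]addrC.
Qed.

Lemma star_swap23 c x y z u v w : star c x y z u v w -> star c x z y u w v.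
Proof. by case=> /balanced_swap23 b t; split=> //; rewrite addrAC. Qed.

Section NotF4.
Hypothesis nF4 : w1 ^+ 2 + w1 * w2 + w2 ^+ 2 != 0.

(** Two different ordered pairs with the same ratio would force [u = v], a zero element, or the
    vanishing of the quadratic form, that is, the excluded [F_4] case. *)
Lemma klein_ratio_uniq u v u' v' : u \in W' -> v \in W' -> u != v ->
  u' \in W' -> v' \in W' -> u' != v' -> u * v' = v * u' -> u = u' /\ v = v'.
Proof.
move=> Wu Wv uv Wu' Wv' uv' e.
have q0 : u ^+ 2 + u * v + v ^+ 2 != 0 by rewrite quad_klein.
have [u0 v0] : u != 0 /\ v != 0.
  by move: Wu Wv; rewrite !in_setD1 => /andP[-> _] /andP[-> _].
have [] := klein_third Wu Wv uv Wu' => u'E; rewrite {}u'E in uv' e *.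
- by move: e; rewrite (mulrC v) => /(mulfI u0).
- have [] := klein_third Wu Wv uv Wv' => v'E; rewrite {}v'E in uv' e.
  + by move: e uv; rewrite -!expr2 => /sqr_inj_pchar2->; rewrite eqxx.
  + by rewrite eqxx in uv'.
  + case/negP: q0; apply/eqP.
    have -> : u ^+ 2 + u * v + v ^+ 2 = u * (u + v) + v * v by ring.
    by rewrite e addxx.
- have [] := klein_third Wu Wv uv Wv' => v'E; rewrite {}v'E in uv' e.
  + case/negP: q0; apply/eqP.
    have -> : u ^+ 2 + u * v + v ^+ 2 = u * u + v * (u + v) by ring.
    by rewrite e addxx.
  + by move/eqP: e; rewrite mulrDr mulrC eq_sym -subr_eq0 addrC addKr mulf_eq0 (negbTE v0).
  + by rewrite eqxx in uv'.
Qed.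

(* The multipliers at [y] in the triples [xyz] and [xyt] differ: otherwise, by
   uniqueness, the balanced triples for [xyz], [xyt], [xzt] fit together and
   their three trace conditions add up to [0 = 1]. *)
Lemma star_column c x y z t u v w u' v' w' u2 v2 w2' :
  x != y -> x != z -> x != t -> z != t ->
  star c x y z u v w -> star c x y t u' v' w' -> star c x z t u2 v2 w2' ->
  v != v'.
Proof.
move=> xy xz xt zt [b1 t1] [b2 t2] [b3 t3]; apply/eqP => vv'.
have e1 := balanced_edge b1; have e2 := balanced_edge b2.
have e3 := balanced_edge b3; have n3 := balanced_neq b3.
have [xz0 xt0] : x + z != 0 /\ x + t != 0 by rewrite !addx_eq0.
rewrite (balanced_sum b1) in t1; rewrite (balanced_sum b2) in t2.
rewrite (balanced_sum b3) in t3.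
case: b1 b2 b3 => -[_ Wv Ww] _ _ [[_ _ Ww'] _ _] [[_ Wv2 Ww2] _ _].
have e : w * (x + z) = w' * (x + t) by rewrite -e1 -e2 vv'.
have ww' : w != w'.
  apply: contraNneq zt => ww'; rewrite -{}ww' in e.
  have w0 : w != 0 by move: Ww; rewrite in_setD1 => /andP[].
  by have /addrI-> := mulfI w0 e.
have [ev ew] : w = v2 /\ w' = w2'.
  apply: klein_ratio_uniq => //; apply: (mulIf xt0).
  by rewrite -mulrA -e3 mulrCA e; ring.
move: t1 t2 t3; rewrite -vv' -ev -ew => t1 t2 t3.
have := trb0 cardF.
have <- : (v + w) * c x + v * c y + w * c z + ((v + w') * c x + v * c y + w' * c t)
   + ((w + w') * c x + w * c z + w' * c t) = 0 by ring2 ch2.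
by rewrite (trbD cardF) (trbD cardF (_ + _ + _)) t1 t2 t3.
Qed.

End NotF4.

Section Quadruple.
Variables (c : F -> F) (x0 x1 x2 x3 : F).
Hypotheses (n01 : x0 != x1) (n02 : x0 != x2) (n03 : x0 != x3).
Hypotheses (n12 : x1 != x2) (n13 : x1 != x3) (n23 : x2 != x3).

Definition spread x y z :=
  exists u v w, star c x y z u v w.

Hypotheses (s012 : spread x0 x1 x2) (s013 : spread x0 x1 x3).
Hypotheses (s023 : spread x0 x2 x3) (s123 : spread x1 x2 x3).

(** In the [F_4] case [x0 + x2] and [x0 + x3] are the two roots of one quadratic equation, whose sum
    is [x0 + x1]. Otherwise the weights of the triples 012, 013, 023 form the rows [u0 a b],
    [v0 p r], [t0 m n], and all arrangements but the symmetric one are excluded. *)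
Lemma quadruple_klein : exists e a b, [/\ e != 0, a \in W', b \in W' & a != b] /\
  [/\ x1 = x0 + e * a, x2 = x0 + e * b & x3 = x0 + e * (a + b)].
Proof.
have [y1 y2] : x0 + x1 != 0 /\ x0 + x2 != 0 by rewrite !addx_eq0.
have final e a b : [/\ e != 0, a \in W', b \in W' & a != b] ->
    [/\ x0 + x1 = e * a, x0 + x2 = e * b & x0 + x3 = e * (a + b)] ->
    exists e a b, [/\ e != 0, a \in W', b \in W' & a != b] /\
  [/\ x1 = x0 + e * a, x2 = x0 + e * b & x3 = x0 + e * (a + b)].
  by move=> ? [E1 E2 E3]; exists e, a, b; rewrite -E1 -E2 -E3 !addKx.
have [u0 [a [b S012]]] := s012; have [v0 [p [r S013]]] := s013.
have [t0 [m [n S023]]] := s023; have [u1 [u2 [u3 S123]]] := s123.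
have [[B012 _] [B013 _] [B023 _]] := And3 S012 S013 S023.
have [Wa Wb] : a \in W' /\ b \in W' by case: B012 => -[].
have [Wp Wr] : p \in W' /\ r \in W' by case: B013 => -[].
have [Wm Wn] : m \in W' /\ n \in W' by case: B023 => -[].
have [a0 b0] : a != 0 /\ b != 0.
  by move: Wa Wb; rewrite !in_setD1 => /andP[-> _] /andP[-> _].
have [r0 n0] : r != 0 /\ n != 0.
  by move: Wr Wn; rewrite !in_setD1 => /andP[-> _] /andP[-> _].
have ab := balanced_neq B012.
have E12 := balanced_edge B012; have E13 := balanced_edge B013.
have E23 := balanced_edge B023.
have e0 : (x0 + x1) / b != 0 by rewrite mulf_neq0 ?invr_neq0.
have E2 : x0 + x2 = (x0 + x1) / b * a.
  by apply: (mulfI b0); rewrite -E12 mulrA (mulrC b) divfK // mulrC.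
have [F4|nF4] := eqVneq (w1 ^+ 2 + w1 * w2 + w2 ^+ 2) 0.
  have quad u v y y' : u \in W' -> v \in W' -> u != v -> u * y = v * y' ->
      y ^+ 2 + y * y' + y' ^+ 2 = 0.
    move=> Wu Wv uv e; have q := quad_klein Wu Wv uv; rewrite {}F4 in q.
    have v0' : v ^+ 2 != 0 by move: Wv; rewrite in_setD1 expf_eq0 => /andP[].
    apply: (mulfI v0'); rewrite mulr0.
    transitivity (v ^+ 2 * y ^+ 2 + v * y * (v * y') + (v * y') ^+ 2); first by ring.
    by rewrite -e -(mulr0 (y ^+ 2)) -q; ring.
  have Q2 := quad _ _ _ _ Wa Wb ab E12.
  have Q3 := quad _ _ _ _ Wp Wr (balanced_neq B013) E13.
  (* The sum of the two quadratic equations factors; the first factor is nonzero because [x2] and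
     [x3] differ. *)
  have : (x0 + x2 + (x0 + x3)) * (x0 + x1 + (x0 + x2) + (x0 + x3)) = 0.
    rewrite -[RHS]addr0 -{1}Q2 -Q3; move: (x0 + x1) (x0 + x2) (x0 + x3) => y y' y''.
    by ring2 ch2.
  move/eqP; rewrite mulf_eq0 => /orP[|].
    by rewrite addx_eq0 // (inj_eq (addrI x0)) (negbTE n23).
  rewrite addx_eq0 // => /eqP E3.
  apply: (final ((x0 + x1) / b) b a); first by split=> //; rewrite eq_sym.
  by split; rewrite -?E3 ?mulrDr -?E2 ?divfK //.
(* Compatibility of the three ratios of [x0 + x1], [x0 + x2], [x0 + x3]. It rules out the
   non-symmetric Latin squares, where it would become an equality of squares. *)
have e : p * b * n = a * r * m.
  apply: (mulIf y2).
  transitivity (n * (p * (b * (x0 + x2)))); first by ring.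
  rewrite -E12 [p * _]mulrCA E13.
  by transitivity (a * r * (n * (x0 + x3))); [ring | rewrite -E23; ring].
have col := star_column nF4.
have [n10 n20 n30] : [/\ x1 != x0, x2 != x0 & x3 != x0] by split; rewrite eq_sym.
have [n21 n31 n32] : [/\ x2 != x1, x3 != x1 & x3 != x2].
  by split; rewrite eq_sym.
(* The Latin property: at each of the four points, different triples carry different weights. The
   permuted forms of [star] bring the point in question into second place, or into first place
   before [star_swap12]. *)
have ap : a != p := col _ _ _ _ _ _ _ _ _ _ _ _ _ _ n01 n02 n03 n23 S012 S013 S023.
have bm : b != m := col _ _ _ _ _ _ _ _ _ _ _ _ _ _ n02 n01 n03 n13
  (star_swap23 S012) S023 S013.
have rn : r != n := col _ _ _ _ _ _ _ _ _ _ _ _ _ _ n03 n01 n02 n12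
  (star_swap23 S013) (star_swap23 S023) S012.
have g1 : u0 != v0 := col _ _ _ _ _ _ _ _ _ _ _ _ _ _ n10 n12 n13 n23
  (star_swap12 S012) (star_swap12 S013) S123.
have g2 : u0 != t0 := col _ _ _ _ _ _ _ _ _ _ _ _ _ _ n20 n21 n23 n13
  (star_swap12 (star_swap23 S012)) (star_swap12 S023) (star_swap12 S123).
have g3 : v0 != t0 := col _ _ _ _ _ _ _ _ _ _ _ _ _ _ n30 n31 n32 n12
  (star_swap12 (star_swap23 S013)) (star_swap12 (star_swap23 S023))
  (star_swap12 (star_swap23 S123)).
have [Wv0 Wt0] : v0 \in W' /\ t0 \in W' by case: B013 B023 => -[? _ _] _ _ [[]].
have [z1 z2] : v0 != 0 /\ t0 != 0.
  by move: Wv0 Wt0; rewrite !in_setD1 => /andP[-> _] /andP[-> _].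
have u0E := balanced_sum B012; rewrite {}u0E in g1 g2.
have rE : r = v0 + p by rewrite (balanced_sum B013) addrC addKx.
have nE : n = t0 + m by rewrite (balanced_sum B023) addrC addKx.
(* The surviving arrangement: the three differences from [x0] are then proportional to [b], [a],
   [a + b]. *)
have good : p = a + b -> r = b -> exists e a b,
    [/\ e != 0, a \in W', b \in W' & a != b] /\
    [/\ x1 = x0 + e * a, x2 = x0 + e * b & x3 = x0 + e * (a + b)].
  move=> pE rb; apply: (final ((x0 + x1) / b) b a); first by split=> //; rewrite eq_sym.
  split=> //; first by rewrite divfK.
  by apply: (mulfI r0); rewrite -E13 pE rb mulrA (mulrC b) divfK // [RHS]mulrC addrC.
have [pE|pE|pE] := klein_third Wa Wb ab Wp; first by rewrite pE eqxx in ap.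
  have [vE|vE|vE] := klein_third Wa Wb ab Wv0; last 2 first.
  - by rewrite rE pE vE addxx ?eqxx in r0.
  - by rewrite vE eqxx in g1.
  have [tE|tE|tE] := klein_third Wa Wb ab Wt0.
  - by rewrite vE tE eqxx in g3.
  - have [mE|mE|mE] := klein_third Wa Wb ab Wm.
    + by rewrite rE nE pE vE mE tE addrC eqxx in rn.
    + by rewrite mE eqxx in bm.
    + move: e; rewrite rE nE pE vE tE mE => e.
      suff ab_b : a + b = b by rewrite -(addxK ch2 a b) ab_b addxx ?eqxx in a0.
      apply: sqr_inj_pchar2; apply: (mulfI a0).
      transitivity (a * (a + b) * (a + b)); first by ring.
      by rewrite -e; ring2 ch2.
  - by rewrite tE eqxx in g2.
have [vE|vE|vE] := klein_third Wa Wb ab Wv0.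
- by apply: good; rewrite // rE vE pE addKx.
- have [tE|tE|tE] := klein_third Wa Wb ab Wt0.
  + have [mE|mE|mE] := klein_third Wa Wb ab Wm.
    * by rewrite nE mE tE addxx ?eqxx in n0.
    * by rewrite mE eqxx in bm.
    * have c0 : a + b != 0 by rewrite addx_eq0.
      move: e; rewrite rE nE pE vE tE mE => e.
      suff a_b : a = b by rewrite a_b eqxx in ab.
      apply: sqr_inj_pchar2; apply: (mulfI c0).
      transitivity (a * (b + (a + b)) * (a + b)); first by ring2 ch2.
      by rewrite -e; ring2 ch2.
  + by rewrite vE tE eqxx in g3.
  + by rewrite tE eqxx in g2.
- by rewrite vE eqxx in g1.
Qed.

End Quadruple.

End FourPoints.

(** * Normal form of the affine part *)

Section NormalForm.
Variables (F : finFieldType) (h : nat).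
Hypothesis cardF : #|F| = (2 ^ h)%N.
Let ch2 : 2 \in [pchar F] := card_finPcharP cardF isT.
Implicit Types (x y z w u v f : F) (c : F -> F).

Lemma klein_addr_closed w1 w2 : addr_closed (klein w1 w2).
Proof.
split=> [|u v uW vW]; first by rewrite !inE eqxx.
exact: (memD_klein cardF uW vW).
Qed.

Lemma Tr_trb z : Tr z = (trb z)%:R.
Proof. by rewrite /trb; case/orP: (Tr01 cardF z) => /eqP->; rewrite ?eqxx ?oner_eq0 ?mulr0n ?mulr1n. Qed.

(** Separation of [w3] from the group generated by [w1] and [w2]. No independence of [w1, w2] is
    assumed, so that [w1 = 0] covers the case of two elements. *)
Lemma trb_dual w1 w2 w3 : w3 \notin klein w1 w2 ->
  exists f, [/\ trb (w1 * f) = false, trb (w2 * f) = false & trb (w3 * f)].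
Proof.
case/(annihilator_sep cardF (klein_addr_closed w1 w2)) => f /annihilatorP Wf Tf.
exists f; split; last by rewrite (trbE cardF) mulrC Tf.
  by rewrite /trb mulrC Wf ?inE ?eqxx ?orbT.
by rewrite /trb mulrC Wf ?inE ?eqxx ?orbT.
Qed.

Lemma trb_if (t : bool) w f : trb (w * (if t then f else 0)) = t && trb (w * f).
Proof. by case: t => //; rewrite mulr0 (trb0 cardF). Qed.

Lemma trb_pair b (t0 t1 : bool) : b != 0 -> b != 1 ->
  exists f, trb f = t0 /\ trb (b * f) = t1.
Proof.
move=> b0 b1.
have [|f0 [_ A0 A1]] := @trb_dual 0 b 1.
  by rewrite !inE !negb_or add0r oner_eq0 eq_sym b1.
have [|f1 [_ B0 B1]] := @trb_dual 0 1 b.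
  by rewrite !inE !negb_or add0r b0 b1.
exists ((if t0 then f0 else 0) + (if t1 then f1 else 0)).
rewrite mulrDr -[X in trb X](mul1r (_ + _)) mulrDr !(trbD cardF) !trb_if.
by rewrite A0 A1 B0 B1 !andbF !andbT addbF.
Qed.

(** The hypotheses say that [1, b, b^2] are independent over [F_2]; [f] is assembled from a dual
    basis. *)
Lemma trb_triple b (t0 t1 t2 : bool) : b != 0 -> b != 1 -> 1 + b + b ^+ 2 != 0 ->
  exists f, [/\ trb f = t0, trb (b * f) = t1 & trb (b ^+ 2 * f) = t2].
Proof.
move=> b0 b1 nF4.
have bb0 : b ^+ 2 != 0 by rewrite expf_eq0.
have bb1 : b ^+ 2 != 1.
  apply: contraNneq b1 => e.
  by apply/eqP/(sqr_inj_pchar2 cardF); rewrite e expr1n.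
have bbb : b ^+ 2 != b.
  by apply: contraNneq b1 => e; apply/eqP/(mulfI b0); rewrite mulr1 -expr2.
have [|f0 [A1 A2 A0]] := @trb_dual b (b ^+ 2) 1.
  rewrite !inE !negb_or oner_eq0 !(eq_sym 1) b1 bb1 /=.
  by rewrite -(addx_eq0 ch2) addrC addrA.
have [|f1 [B0 B2 B1]] := @trb_dual 1 (b ^+ 2) b.
  rewrite !inE !negb_or b0 b1 eq_sym bbb /=.
  by rewrite -(addx_eq0 ch2) addrA (addrC b).
have [|f2 [C0 C1 C2]] := @trb_dual 1 b (b ^+ 2).
  rewrite !inE !negb_or bb0 bb1 bbb /=.
  by rewrite -(addx_eq0 ch2) addrC.
exists ((if t0 then f0 else 0) + (if t1 then f1 else 0) + (if t2 then f2 else 0)).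
rewrite !mulrDr -[X in trb X](mul1r (_ + _)) !mulrDr !(trbD cardF) !trb_if.
by rewrite A0 A1 A2 B0 B1 B2 C0 C1 C2 !andbF !andbT !addbF.
Qed.

(* The affine part of [A_{1/b^2, b, 0, 0}]: its points are [(1, u, v)]. *)
Definition affine_arc b u v : bool := u == Tr v + (b + 1) * Tr (b * v).

Section Shear.
Variables (H X : {set F}) (c : F -> F) (w1 w2 x0 e : F).
Hypotheses (clH : addr_closed H) (basis_w : klein_basis w1 w2).
Hypothesis annH : annihilator H = klein w1 w2.
Hypothesis e_neq0 : e != 0.
Let b := w2 / w1.
Hypothesis XE : X = [set x0; x0 + e; x0 + e * b; x0 + e * (b + 1)].

Lemma mem_annihilator_klein z : (z \in H) = ~~ trb (w1 * z) && ~~ trb (w2 * z).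
Proof.
rewrite -(annihilatorK cardF clH) annH; apply/annihilatorP/andP => [zW|[t1 t2]].
  by rewrite /trb !negbK ![_ * z]mulrC !zW ?inE ?eqxx ?orbT.
move=> w; rewrite !inE -!orbA mulrC => /or4P[] /eqP->; rewrite ?mul0r ?(Tr0 cardF) //.
- by apply/eqP; rewrite -[_ == _]negbK.
- by apply/eqP; rewrite -[_ == _]negbK.
apply/eqP; rewrite -[_ == _]negbK -/(trb _) mulrDl (trbD cardF).
by rewrite (negbTE t1) (negbTE t2).
Qed.

Let p x := trb (w1 * (c x0 + c x)).
Let q x := trb (w2 * (c x0 + c x)).
Let x1 := x0 + e.
Let x2 := x0 + e * b.
Let x3 := x0 + e * (b + 1).

Hypothesis eq12 : q x1 (+) p x2.
Hypothesis eq13 : p x1 (+) q x1 (+) p x3.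
Hypothesis eq23 : p x2 (+) q x2 (+) q x3.

(** Over each of [u = 1, b, b + 1] the fibre is fixed by two bits. The shear [f] normalises both
    bits at [1] and the second at [b]; the three hypotheses [eq12], [eq13], [eq23] supply the other
    three. *)
Lemma shear_normal_form f :
  [/\ trb f = ~~ p x1, trb (b * f) = q x1 & trb (b ^+ 2 * f) = ~~ q x2] ->
  forall u v, (e * u + x0 \in X) &&
    (w1^-1 * v + f / w1 * u + c x0 + c (e * u + x0) \in H) = affine_arc b u v.
Proof.
case=> f0 f1 f2 u v; have [w1_0 w2_0 w12] := and3P basis_w.
have b0 : b != 0 by rewrite mulf_neq0 ?invr_neq0.
have b1 : b != 1.
  by apply: contraNneq w12 => b1; rewrite -(divfK w1_0 w2) -/b b1 mul1r.
have b10 : b + 1 != 0 by rewrite addx_eq0.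
have w2E : w2 = b * w1 by rewrite divfK.
have inX : (e * u + x0 \in X) = [|| u == 0, u == 1, u == b | u == b + 1].
  have E y : (e * u + x0 == x0 + e * y) = (u == y).
    by rewrite addrC (inj_eq (addrI x0)) (inj_eq (mulfI e_neq0)).
  have := (E 0, E 1); rewrite mulr0 mulr1 addr0 => E01.
  by rewrite XE !inE -!orbA !E01 !E.
have inH : (w1^-1 * v + f / w1 * u + c x0 + c (e * u + x0) \in H) =
    ~~ (trb v (+) trb (f * u) (+) p (x0 + e * u)) &&
    ~~ (trb (b * v) (+) trb (b * f * u) (+) q (x0 + e * u)).
  rewrite mem_annihilator_klein /p /q -!(trbD cardF) (addrC _ x0).
  congr (_ && _); congr (~~ _); congr trb; last rewrite w2E; field=> //.
rewrite inH inX /affine_arc !Tr_trb.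
have p0 : p x0 = false by rewrite /p addxx // mulr0 (trb0 cardF).
have q0 : q x0 = false by rewrite /q addxx // mulr0 (trb0 cardF).
have f1' : trb (f * b) = q x1 by rewrite mulrC.
have f2' : trb (b * f * b) = ~~ q x2 by rewrite mulrAC -expr2.
have f3 : trb (f * (b + 1)) = q x1 (+) ~~ p x1.
  by rewrite mulrDr mulr1 (trbD cardF) mulrC f1 f0.
have f4 : trb (b * f * (b + 1)) = ~~ q x2 (+) q x1.
  by rewrite mulrDr mulr1 (trbD cardF) mulrAC -expr2 f2 f1.
move: eq12 eq13 eq23 f0 f1 f1' f2' f3 f4; rewrite /x1 /x2 /x3.
have [nb1 nb b_neq1] : [/\ b + 1 != b, b + 1 != 1 & 1 != b].
  split; last by rewrite eq_sym.
    by rewrite -subr_eq0 addrAC addrN add0r oner_eq0.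
  by rewrite -subr_eq0 addrK.
have z01 : (0 == 1 :> F) = false by rewrite eq_sym oner_eq0.
have zb : (0 == b) = false by rewrite eq_sym; exact: negbTE.
have zb1 : (0 == b + 1) = false by rewrite eq_sym; exact: negbTE.
move=> E12 E13 E23 g0 g1 g1' g2' g3 g4.
have V11 : 1 + (b + 1) * 1 = b by rewrite mulr1 addrC addxK.
have [->|u0] := eqVneq u 0.
  rewrite !mulr0 addr0 p0 q0 (trb0 cardF) !addbF /=.
  by case: (trb v); case: (trb (b * v));
    rewrite /= ?V11 ?mulr0 ?mulr1 ?addr0 ?add0r ?eqxx ?(z01, zb, zb1).
have [->|u1] := eqVneq u 1.
  rewrite !mulr1 g0 g1 /=; case: (p _); case: (q _);
  case: (trb v); case: (trb (b * v));
    rewrite /= ?V11 ?mulr0 ?mulr1 ?addr0 ?add0r ?eqxx ?oner_eq0 ?[1 == b + 1]eq_sym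
      ?(negbTE b_neq1) ?(negbTE nb1) ?(negbTE nb) //.
have [->|ub] := eqVneq u b.
  rewrite g1' g2' /=; move: E12 E13 E23.
  case: (p (x0 + e)) => /=; case: (q (x0 + e)) => /=; case: (p (x0 + e * b)) => //=;
  case: (q (x0 + e * b)) => /=; case: (trb v); case: (trb (b * v)) => _ _ _;
    rewrite /= ?V11 ?mulr0 ?mulr1 ?addr0 ?add0r ?eqxx ?(negbTE b0) ?(negbTE b1)
      ?[b == b + 1]eq_sym ?(negbTE nb1) ?(negbTE nb) //.
have [->|ub1] := eqVneq u (b + 1).
  rewrite g3 g4 /=; move: E12 E13 E23.
  case: (p (x0 + e)) => /=; case: (q (x0 + e)) => /=; case: (p (x0 + e * b)) => //=;
  case: (q (x0 + e * b)) => /=; case: (p _) => //=; case: (q _) => //=;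
  case: (trb v); case: (trb (b * v)) => _ _ _;
    rewrite /= ?V11 ?mulr0 ?mulr1 ?addr0 ?add0r ?eqxx ?(negbTE b0) ?(negbTE b10)
      ?(negbTE nb1) ?(negbTE nb) //.
by case: (trb v); case: (trb (b * v));
  rewrite /= ?V11 ?mulr0 ?mulr1 ?addr0 ?add0r; apply/esym/negbTE.
Qed.

End Shear.
End NormalForm.

(** * Trace conditions on the four vertical lines *)

Section KleinEquations.
Variables (F : finFieldType) (h : nat).
Hypothesis cardF : #|F| = (2 ^ h)%N.
Let ch2 : 2 \in [pchar F] := card_finPcharP cardF isT.
Implicit Types (x y z w u v f : F) (c : F -> F).

Lemma klein_eq w1 w2 a b : klein_basis w1 w2 ->
  a \in klein w1 w2 :\ (0%R : F) -> b \in klein w1 w2 :\ (0%R : F) -> a != b ->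
  klein a b = klein w1 w2 /\ klein_basis a b.
Proof.
move=> basis_w Wa Wb ab; have [a0 a_in] := setD1P Wa; have [b0 b_in] := setD1P Wb.
split; last by rewrite /klein_basis a0 b0.
apply/setP => w; apply/idP/idP.
  rewrite !inE -!orbA => /or4P[] /eqP->; rewrite ?eqxx //.
  - by have := a_in; rewrite !inE -!orbA.
  - by have := b_in; rewrite !inE -!orbA.
  - by have := memD_klein cardF a_in b_in; rewrite !inE -!orbA.
move=> Ww; have [->|w0] := eqVneq w 0; first by rewrite !inE eqxx.
have Ww' : w \in klein w1 w2 :\ (0%R : F) by apply/setD1P.
by have [] := klein_third cardF basis_w Wa Wb ab Ww' => ->; rewrite !inE eqxx ?orbT.
Qed.

Lemma klein_mem a b : klein_basis a b ->
  [/\ a \in klein a b :\ (0%R : F), b \in klein a b :\ (0%R : F)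
    & a + b \in klein a b :\ (0%R : F)].
Proof.
by case/and3P=> a0 b0 ab; rewrite !inE a0 b0 addx_eq0 // ab !eqxx ?orbT.
Qed.

Section Equations.
Variables (c : F -> F) (a b x0 e : F).
Hypotheses (basis_ab : klein_basis a b) (e0 : e != 0).
Let B := b / a.
Let x1 := x0 + e.
Let x2 := x0 + e * B.
Let x3 := x0 + e * (B + 1).
Let p w x := trb (w * (c x0 + c x)).

(** Substituting [u = v + w] leaves only sums of two values of [c]. *)
Lemma star_trb x y z u v w : star a b c x y z u v w ->
  trb (v * (c x + c y)) (+) trb (w * (c x + c z)).
Proof.
case=> bal; rewrite (balanced_sum cardF bal) -(trbD cardF).
by congr (is_true (trb _)); ring.
Qed.

Lemma star_ratio x y z s t u v w : star a b c x y z u v w ->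
  x + y = e * s -> x + z = e * t -> v * s = w * t.
Proof.
move=> S E1 E2; apply: (mulfI e0).
by rewrite mulrCA -E1 (balanced_edge cardF S.1) E2 mulrCA.
Qed.

Hypotheses (s012 : spread a b c x0 x1 x2) (s013 : spread a b c x0 x1 x3).
Hypotheses (s023 : spread a b c x0 x2 x3) (s123 : spread a b c x1 x2 x3).

Let d01 : x0 + x1 = e * 1. Proof. by rewrite mulr1 addKx. Qed.
Let d02 : x0 + x2 = e * B. Proof. by rewrite addKx. Qed.
Let d03 : x0 + x3 = e * (B + 1). Proof. by rewrite addKx. Qed.

(** The positions fix the ratio of the weights, and outside the [F_4] case the ratio fixes the
    weights themselves; each equation is the trace condition of one triple. *)
Lemma klein_equations_nF4 : a ^+ 2 + a * b + b ^+ 2 != 0 ->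
  [/\ p b x1 (+) p a x2, p a x1 (+) p b x1 (+) p a x3
    & p a x2 (+) p b x2 (+) p b x3].
Proof.
move=> nF4; have [Wa Wb Wc] := klein_mem basis_ab.
have [a0 b0 ab] := and3P basis_ab.
have BE : B * a = b by rewrite divfK.
have cE : (B + 1) * a = a + b by rewrite mulrDl mul1r BE addrC.
have ca : a + b != a by rewrite -subr_eq0 addrAC addrN add0r.
have cb : a + b != b by rewrite -subr_eq0 addrK.
have uniq x y z s t u v w : star a b c x y z u v w ->
    x + y = e * s -> x + z = e * t -> t * a \in klein a b :\ (0%R : F) ->
    s * a \in klein a b :\ (0%R : F) -> t * a != s * a ->
    v = t * a /\ w = s * a.
  move=> S E1 E2 Wt Ws ts; have nvw := balanced_neq cardF S.1.
  have := star_ratio S E1 E2; case: S => -[[_ Wv Ww] _ _] _ E.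
  apply: (klein_ratio_uniq cardF basis_ab nF4 Wv Ww nvw Wt Ws ts).
  by rewrite mulrA E; ring.
split.
- have [u [v [w S]]] := s012; have := star_trb S.
  by have [|||-> ->] := uniq _ _ _ _ _ _ _ _ S d01 d02; rewrite ?BE ?mul1r // eq_sym.
- have [u [v [w S]]] := s013; have := star_trb S.
  have [|||-> ->] := uniq _ _ _ _ _ _ _ _ S d01 d03; rewrite ?cE ?mul1r //.
  by rewrite mulrDl (trbD cardF).
- have [u [v [w S]]] := s023; have := star_trb S.
  have [|||-> ->] := uniq _ _ _ _ _ _ _ _ S d02 d03; rewrite ?cE ?BE //.
  by rewrite mulrDl (trbD cardF).
Qed.

(** Here the ratio fixes the weights of a triple only up to multiplication by a power of [B]. The
    hypotheses say that for [x0, x1, x2] the trace condition holds with weights [b, a] at [x1, x2]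
    and fails after multiplication by [B]; the possible weights of the other triples are then
    enumerated. *)
Lemma klein_equations_F4 : a ^+ 2 + a * b + b ^+ 2 = 0 ->
  p b x1 (+) p a x2 -> ~~ (p a x1 (+) p b x1 (+) p b x2) ->
  p a x1 (+) p b x1 (+) p a x3 /\ p a x2 (+) p b x2 (+) p b x3.
Proof.
move=> F4 eq1 eq2; have [Wa Wb Wc] := klein_mem basis_ab.
have [a0 b0 ab] := and3P basis_ab.
have aB : a * B = b by rewrite mulrC divfK.
have bB : b * B = a + b.
  apply: (mulfI a0); rewrite mulrCA aB.
  by apply/eqP; rewrite -addx_eq0 // -F4; apply/eqP; ring.
have cB : (a + b) * B = a by rewrite mulrDl aB bB addrC addxK.
have aD : a * B + a = a + b by rewrite aB addrC.
have bD : b * B + b = a by rewrite bB addxK.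
have cD : (a + b) * B + (a + b) = b by rewrite cB addKx.
have third w : w \in klein a b :\ (0%R : F) -> [\/ w = a, w = b | w = a + b].
  exact: (klein_third cardF basis_ab Wa Wb ab).
have bits w : trb ((a + b) * w) = trb (a * w) (+) trb (b * w).
  by rewrite mulrDl (trbD cardF).
have [u [v [w S]]] := s013; have T13 := star_trb S.
have := star_ratio S d01 d03; rewrite mulr1 mulrDr mulr1 => E13.
have {S} [[[_ _ /third Ww] _ _] _] := S.
have [u2 [v2 [w2 S]]] := s023; have T23 := star_trb S.
have := star_ratio S d02 d03.
have B0 : B != 0 by rewrite mulf_neq0 ?invr_neq0.
have B1 : B + 1 = B * B by apply: (mulfI a0); rewrite mulrA aB bB mulrDr mulr1 aB addrC.
rewrite B1 mulrA => /(mulIf B0) E23.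
have {S} [[[_ _ /third Ww2] _ _] _] := S.
have [u3 [v3 [w3 S]]] := s123; have T123 := star_trb S.
have d12 : x1 + x2 = e * (B * B) by rewrite -B1 /x1 /x2; ring2 ch2.
have d13 : x1 + x3 = e * B by rewrite /x1 /x3; ring2 ch2.
have := star_ratio S d12 d13; rewrite mulrA => /(mulIf B0) E123.
have {S} [[[_ /third Wv3 _] _ _] _] := S.
move: eq1 eq2 T13 T23 T123; rewrite -{}E123 {}E13 {}E23.
have d x y : c x + c y = (c x0 + c x) + (c x0 + c y) by ring2 ch2.
rewrite [c x1 + c x2]d [c x1 + c x3]d ![_ * (_ + (c x0 + _))]mulrDr !(trbD cardF) /p.
case: Ww Ww2 Wv3 => [->|->|->] [->|->|->] [->|->|->];
  rewrite ?(aD, bD, cD) ?(aB, bB, cB) ?bits;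
  case: (trb (a * (c x0 + c x1))); case: (trb (b * (c x0 + c x1)));
  case: (trb (a * (c x0 + c x2))); case: (trb (b * (c x0 + c x2)));
  case: (trb (a * (c x0 + c x3))); case: (trb (b * (c x0 + c x3))) => //.
Qed.

End Equations.

End KleinEquations.

(** * Reduction of the affine part to normal form *)

Section AffineNormalForm.
Variables (F : finFieldType) (h : nat).
Hypothesis cardF : #|F| = (2 ^ h)%N.
Let ch2 : 2 \in [pchar F] := card_finPcharP cardF isT.
Implicit Types (x y z w u v f : F) (c : F -> F).

Lemma affine_normal_form (H X : {set F}) c :
  addr_closed H -> #|F| = (4 * #|H|)%N -> (4 <= #|X|)%N ->
  (forall x y z, x \in X -> y \in X -> z \in X -> x != y -> x != z -> y != z ->
     forall s d, [&& s * x + d + c x \in H, s * y + d + c y \in H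
                   & s * z + d + c z \in H] -> False) ->
  exists b m x0 k f d, [/\ b != 0, b != 1, m != 0 & k != 0] /\
    forall u v, (m * u + x0 \in X) &&
      (k * v + f * u + d + c (m * u + x0) \in H) = affine_arc b u v.
Proof.
move=> clH cFH X4 nocol.
have [w1 [w2 [basis_w annH]]] := annihilator_klein cardF clH cFH.
have spr v1 v2 x y z : annihilator H = klein v1 v2 ->
    x \in X -> y \in X -> z \in X -> x != y -> x != z -> y != z ->
    spread v1 v2 c x y z.
  move=> annH' Xx Xy Xz xy xz yz; rewrite /spread /star -annH'.
  exact: (balanced_of_noncollinear cardF clH xy xz yz (nocol _ _ _ Xx Xy Xz xy xz yz)).
have [x0 [x1 [x2 [x3 [[X0 X1 X2 X3] [n01 n02 n03] [n12 n13 n23]]]]]] :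
  exists x0 x1 x2 x3, [/\ [/\ x0 \in X, x1 \in X, x2 \in X & x3 \in X],
     [/\ x0 != x1, x0 != x2 & x0 != x3] & [/\ x1 != x2, x1 != x3 & x2 != x3]].
  move: X4 (enum_uniq X) (mem_enum X); rewrite cardE.
  case: (enum X) => [|x0 [|x1 [|x2 [|x3 s]]]] // _ us memX.
  move: us; rewrite /= !inE !negb_or -!andbA; do 9![case/andP=> ?] => _.
  by exists x0, x1, x2, x3; rewrite -!memX !inE !eqxx ?orbT.
have quad y : y \in X -> x0 != y -> x1 != y -> x2 != y ->
    exists e a b, [/\ e != 0, a \in klein w1 w2 :\ (0%R : F),
      b \in klein w1 w2 :\ (0%R : F) & a != b] /\
      [/\ x1 = x0 + e * a, x2 = x0 + e * b & y = x0 + e * (a + b)].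
  by move=> Xy n0 n1 n2; apply: (quadruple_klein cardF basis_w) => //; apply: spr.
have [e [a [b [[e0 Wa Wb ab] [E1 E2 E3]]]]] := quad _ X3 n03 n13 n23.
have [a0 _] := setD1P Wa.
(* Since [x0, x1, x2] determine the fourth element, [X] has no fifth one. *)
have sumE y : y \in X -> x0 != y -> x1 != y -> x2 != y -> y = x0 + x1 + x2.
  move=> Xy n0 n1 n2; have [e' [a' [b' [_ [-> -> ->]]]]] := quad _ Xy n0 n1 n2.
  by ring2 ch2.
set E := e * a; set B := b / a.
have EB : E * B = e * b by rewrite /E /B -mulrA (mulrCA a) divff // mulr1.
have E0 : E != 0 by rewrite mulf_neq0.
have XE : X = [set x0; x0 + E; x0 + E * B; x0 + E * (B + 1)].
  rewrite [E * (B + 1)]mulrDr mulr1 EB (addrC (e * b)) -mulrDr -E1 -E2 -E3.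
  apply/setP => y; rewrite !inE -!orbA; apply/idP/idP => [Xy|]; last first.
    by case/or4P=> /eqP->.
  have [//|n0] := eqVneq y x0; have [//|n1] := eqVneq y x1.
  have [//|n2] := eqVneq y x2; rewrite /= (sumE _ X3) // -(sumE y) ?eqxx //;
  by rewrite eq_sym.
have [kab basis_ab] := klein_eq cardF basis_w Wa Wb ab.
have sp v1 v2 : annihilator H = klein v1 v2 ->
  [/\ spread v1 v2 c x0 x1 x2, spread v1 v2 c x0 x1 x3, spread v1 v2 c x0 x2 x3
    & spread v1 v2 c x1 x2 x3].
  by move=> annH'; split; apply: spr.
have EBb : E * (B + 1) = e * (a + b) by rewrite mulrDr mulr1 EB addrC -mulrDr.
rewrite {}E1 {}E2 {}E3 -EB -/E -EBb {quad sumE n01 n02 n03 n12 n13 n23 X0 X1 X2 X3} in sp.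
rewrite -{}kab in annH.
pose p w x := trb (w * (c x0 + c x)).
(* It remains to choose a basis of [W] with ratio [B] and the shear. In the [F_4] case three bases
   have this ratio, and the choice among them matters. *)
suff [w [k [f [annwk [basis_wk wkB] [q12 q13 q23] [t0 t1 t2]]]]] : exists w k f,
   [/\ annihilator H = klein w k, klein_basis w k /\ k / w = B,
       [/\ p k (x0 + E) (+) p w (x0 + E * B),
           p w (x0 + E) (+) p k (x0 + E) (+) p w (x0 + E * (B + 1))
         & p w (x0 + E * B) (+) p k (x0 + E * B) (+) p k (x0 + E * (B + 1))]
     & [/\ trb f = ~~ p w (x0 + E), trb (B * f) = p k (x0 + E)
         & trb (B ^+ 2 * f) = ~~ p k (x0 + E * B)]].
  rewrite -{}wkB in XE q12 q13 q23 t0 t1 t2.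
  exists (k / w), E, x0, w^-1, (f / w), (c x0); split.
    have [w0 k0 wk] := and3P basis_wk; rewrite invr_neq0 // E0 mulf_neq0 ?invr_neq0 //.
    split=> //; apply: contraNneq wk => wk1; rewrite -(divfK w0 k) wk1 mul1r //.
  exact: (shear_normal_form cardF clH basis_wk annwk E0 XE q12 q13 q23 (And3 t0 t1 t2)).
have aB : a * B = b by rewrite mulrC divfK.
have B0 : B != 0.
  by have [_ + _] := and3P basis_ab; apply: contraNneq => B0; rewrite -aB B0 mulr0.
have B1 : B != 1 by apply: contraNneq ab => B1; rewrite -aB B1 mulr1.
have quadB : a ^+ 2 * (1 + B + B ^+ 2) = a ^+ 2 + a * b + b ^+ 2.
  by rewrite -aB; ring.
have [F4|nF4] := eqVneq (a ^+ 2 + a * b + b ^+ 2) 0; last first.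
  have [s012 s013 s023 _] := sp _ _ annH.
  have eqs := klein_equations_nF4 cardF basis_ab E0 s012 s013 s023 nF4.
  have nB : 1 + B + B ^+ 2 != 0.
    by apply: contraNneq nF4; rewrite -quadB => ->; rewrite mulr0.
  have [f ft] := trb_triple cardF (~~ p a (x0 + E)) (p b (x0 + E))
    (~~ p b (x0 + E * B)) B0 B1 nB.
  by exists a, b, f.
have BB : B * B = B + 1.
  apply/eqP; rewrite -(addx_eq0 ch2) (_ : B * B + (B + 1) = 1 + B + B ^+ 2); last by ring.
  by move/eqP: quadB; rewrite F4 mulf_eq0 expf_eq0 (negbTE a0).
have F4w w : w ^+ 2 + w * (w * B) + (w * B) ^+ 2 = 0.
  transitivity (w ^+ 2 * (1 + B + B * B)); first by ring.
  by rewrite BB (addrC B) addxx // mulr0.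
have WB w : w \in klein a b :\ (0%R : F) -> w * B \in klein a b :\ (0%R : F).
  have [? ? ?] := klein_mem cardF basis_ab.
  have bB : b * B = a + b by rewrite -aB -mulrA BB; ring.
  rewrite (klein_nz cardF basis_ab) => /or3P[] /eqP->; rewrite ?aB ?bB //.
  by rewrite mulrDl aB bB addrC addxK.
pose d1 := c x0 + c (x0 + E); pose d2 := c x0 + c (x0 + E * B).
(* As [1 + B + B^2 = 0], the trace expressions of [x0, x1, x2] for [w], [w B], [w B^2] sum to 0. One
   of them is 1, hence exactly two are, and [w] can be chosen so that its own is 1 and the next is
   0. *)
have [w Ww [T1 T2]] : exists2 w, w \in klein a b :\ (0%R : F) &
    trb (w * B * d1) (+) trb (w * d2) /\
    ~~ (trb (w * d1) (+) trb (w * B * d1) (+) trb (w * B * d2)).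
  have [s012 _ _ _] := sp _ _ annH; have [u [v [w S]]] := s012.
  have := star_ratio cardF E0 S; rewrite -{1}[E]mulr1 !addKx // => /(_ _ _ erefl erefl).
  rewrite mulr1 => vE.
  have := star_trb cardF S; rewrite {}vE -/d1 -/d2 => T1.
  have Ww : w \in klein a b :\ (0%R : F) by case: S => -[[]].
  have [T2|T2] := boolP (trb (w * d1) (+) trb (w * B * d1) (+) trb (w * B * d2)); last by exists w.
  exists (w * B); first exact: WB.
  rewrite -[w * B * B]mulrA BB ![w * (B + 1)]mulrDr mulr1 ![(_ + w) * _]mulrDl.
  rewrite !(trbD cardF); move: T1 T2.
  by case: (trb _); case: (trb _); case: (trb _); case: (trb _).
have WwB := WB w Ww; have wwB : w != w * B.
  have [w0 _] := setD1P Ww.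
  by apply: contra_neq B1 => /esym wB; apply: (mulfI w0); rewrite mulr1.
have [kw basis_wwB] := klein_eq cardF basis_ab Ww WwB wwB.
rewrite -{}kw in annH; have [s012 s013 s023 s123] := sp _ _ annH.
have wBB : w * B / w = B by rewrite mulrC mulKf //; have [] := setD1P Ww.
have := @klein_equations_F4 F h cardF c w (w * B) x0 E basis_wwB E0.
rewrite wBB => /(_ s013 s023 s123 (F4w w) T1 T2) [q13 q23].
(* Only two bits can be prescribed here, since [B^2 = B + 1]; the third comes out right by [T2]. *)
have [f [t0 t1]] := trb_pair cardF (~~ p w (x0 + E)) (p (w * B) (x0 + E)) B0 B1.
exists w, (w * B), f; split=> //; split=> //.
rewrite expr2 BB mulrDl mul1r (trbD cardF) t0 t1; move: T2; rewrite /p -/d1 -/d2.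
by case: (trb _); case: (trb _); case: (trb _).
Qed.

End AffineNormalForm.

(** * Coordinates and frames *)

Section Coordinates.
Variable F : finFieldType.
Implicit Types (P : point F) (l m : line F) (g : 'M[F]_3).
Implicit Types (u : 'rV[F]_3) (v : 'cV[F]_3).

Lemma vec3E u : u = vec3 (u 0 0) (u 0 1) (u 0 2%:R).
Proof.
apply/rowP => j; rewrite !mxE; case: j => -[|[|[|//]]] lt_j /=; congr (u _ _);
  exact/val_inj.
Qed.

Lemma vec3_inj x y z x' y' z' : vec3 x y z = vec3 x' y' z' :> 'rV[F]_3 ->
  [/\ x = x', y = y' & z = z'].
Proof.
move=> /rowP e; split; [have := e 0 | have := e 1 | have := e 2%:R];
  by rewrite !mxE.
Qed.

Lemma vec3Z k x y z : k *: vec3 x y z = vec3 (k * x) (k * y) (k * z) :> 'rV[F]_3.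
Proof. by rewrite [LHS]vec3E !mxE. Qed.

Lemma vec3_eq0 x y z :
  (vec3 x y z == 0 :> 'rV[F]_3) = [&& x == 0, y == 0 & z == 0].
Proof.
apply/eqP/and3P => [e|[/eqP-> /eqP-> /eqP->]].
  by move/rowP: e => e; have := (e 0, e 1, e 2%:R); rewrite !mxE /= => -[[-> ->] ->].
by rewrite [RHS]vec3E !mxE.
Qed.

Definition rows3 (r0 r1 r2 : 'rV[F]_3) : 'M[F]_3 := \matrix_i nth 0 [:: r0; r1; r2] i.

Lemma vec3_rows3 x y z r0 r1 r2 :
  vec3 x y z *m rows3 r0 r1 r2 = x *: r0 + y *: r1 + z *: r2.
Proof.
rewrite mulmx_sum_row !big_ord_recl big_ord0 addr0 !rowK !mxE /= addrA.
by [].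
Qed.

Lemma vec3_tr x y z a b c :
  (vec3 x y z *m (vec3 a b c)^T == 0 :> 'M[F]_1) = (x * a + y * b + z * c == 0).
Proof.
apply/eqP/eqP => [/matrixP/(_ 0 0)|e]; last (apply/matrixP => i j; rewrite !ord1).
all: by rewrite !mxE !big_ord_recl big_ord0 !mxE /= addr0 addrA.
Qed.

Lemma is_subsp_genmx n (M : 'M[F]_(n, 3)) : is_subsp (\rank M) <<M>>%MS.
Proof. by rewrite /is_subsp genmx_id eqxx mxrank_gen /=. Qed.

Lemma vec3_100_rank : is_subsp 1 <<vec3 (1 : F) 0 0>>%MS.
Proof. by have := is_subsp_genmx (vec3 (1 : F) 0 0); rewrite rank_rV vec3_eq0 oner_eq0. Qed.

(** The zero vector yields the default point [(1, 0, 0)]. *)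
Definition pt u : point F := insubd (Sub _ vec3_100_rank : point F) <<u>>%MS.

Lemma val_pt u : u != 0 -> val (pt u) = <<u>>%MS.
Proof.
by move=> u0; rewrite /pt insubdK //; have := is_subsp_genmx u; rewrite rank_rV u0.
Qed.

Lemma pt_surj P : exists2 u, u != 0 & P = pt u.
Proof.
have /andP[/eqP genP /eqP rkP] := valP P.
have u0 : nz_row (val P) != 0 by rewrite nz_row_eq0 -mxrank_eq0 rkP.
exists (nz_row (val P)) => //; apply: val_inj; rewrite val_pt // -{1}genP.
apply/eqP; rewrite eq_sym; apply/eqP/eq_genmx/eqmxP.
by rewrite -(mxrank_leqif_eq (nz_row_sub _)) rkP rank_rV u0.
Qed.

Lemma pt_eqP u1 u2 : u1 != 0 -> u2 != 0 ->
  reflect (exists2 k, k != 0 & u1 = k *: u2) (pt u1 == pt u2).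
Proof.
move=> n1 n2; apply: (iffP eqP) => [/(congr1 val)|[k k0 e]].
  rewrite !val_pt // => /genmxP/andP[/sub_rVP[k e] _]; exists k => //.
  by apply: contraNneq n1 => k0; rewrite e k0 scale0r.
by apply: val_inj; rewrite !val_pt // e; apply/eq_genmx/eqmx_scale.
Qed.

Lemma val_pt_eq P u : u != 0 -> (val P == u)%MS = (P == pt u).
Proof.
have [w w0 ->] := pt_surj P => u0.
rewrite -(inj_eq val_inj) !val_pt // !genmxE.
by apply/idP/eqP => [/genmxP|/genmxP].
Qed.

Lemma kermx_rank v : v != 0 -> \rank (kermx v) = 2.
Proof. by move=> v0; rewrite mxrank_ker -mxrank_tr rank_rV trmx_eq0 v0. Qed.

Lemma col_100_rank : is_subsp 2 <<kermx (vec3 (1 : F) 0 0)^T>>%MS.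
Proof.
have := is_subsp_genmx (kermx (vec3 (1 : F) 0 0)^T).
by rewrite kermx_rank // trmx_eq0 vec3_eq0 oner_eq0.
Qed.

(** Lines are given by columns of coefficients, dually to points; the zero column yields a default
    line. *)
Definition ln v : line F := insubd (Sub _ col_100_rank : line F) <<kermx v>>%MS.

Lemma val_ln v : v != 0 -> val (ln v) = <<kermx v>>%MS.
Proof.
by move=> v0; rewrite /ln insubdK //; have := is_subsp_genmx (kermx v); rewrite kermx_rank.
Qed.

Lemma on_ln u v : u != 0 -> v != 0 -> (pt u \in points_on (ln v)) = (u *m v == 0).
Proof. by move=> u0 v0; rewrite inE val_pt // val_ln // !genmxE sub_kermx. Qed.

Lemma ln_scale k v : k != 0 -> v != 0 -> ln (k *: v) = ln v.
Proof.
move=> k0 v0; apply: val_inj; rewrite !val_ln ?scaler_eq0 ?negb_or ?k0 //.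
apply/eq_genmx/eqmxP/andP; split; rewrite sub_kermx; last first.
  by rewrite -scalemxAr mulmx_ker scaler0.
by rewrite -[_ *m v]scale1r -(mulVf k0) -scalerA scalemxAr mulmx_ker scaler0.
Qed.

Lemma ln_surj l : exists2 v, v != 0 & l = ln v.
Proof.
have /andP[/eqP genl /eqP rkl] := valP l.
pose C := (cokermx (val l))^T; pose v := (nz_row C)^T.
have v0 : v != 0.
  by rewrite trmx_eq0 nz_row_eq0 trmx_eq0 -mxrank_eq0 mxrank_coker rkl.
exists v => //; apply: val_inj; rewrite val_ln // -{1}genl.
apply/eq_genmx/eqmxP; have lv : (val l <= kermx v)%MS.
  have /submxP[D vE] := nz_row_sub C.
  by rewrite sub_kermx /v vE trmx_mul trmxK mulmxA mulmx_coker mul0mx.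
by rewrite -(mxrank_leqif_eq lv) rkl kermx_rank.
Qed.

Lemma ln_neq v v' : v != 0 -> v' != 0 -> ln v != ln v' ->
  exists2 u, u *m v = 1%:M & u *m v' = 0.
Proof.
move=> v0 v0' ne.
have : ~~ (kermx v' <= kermx v)%MS.
  apply: contra ne => s; apply/eqP/val_inj; rewrite !val_ln //.
  by apply/esym/eq_genmx/eqmxP; rewrite -(mxrank_leqif_eq s) !kermx_rank.
case/row_subPn => i; rewrite sub_kermx => ni.
have kv : row i (kermx v') *m v' = 0 by rewrite -row_mul mulmx_ker row0.
have nz : (row i (kermx v') *m v) 0 0 != 0.
  by apply: contraNneq ni => e; apply/eqP/matrixP => a b; rewrite !ord1 e mxE.
exists (((row i (kermx v') *m v) 0 0)^-1 *: row i (kermx v')); last first.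
  by rewrite -scalemxAl kv scaler0.
rewrite -scalemxAl; apply/matrixP => a b; rewrite !ord1 [LHS]mxE mulVf //.
by rewrite mxE.
Qed.

End Coordinates.

(* Homogeneous coordinates with respect to the rows of [g]; [fln g a b c] has the
   equation [a x + b y + c z = 0]. *)
Definition fpt (F : finFieldType) (g : 'M[F]_3) x y z : point F := pt (vec3 x y z *m g).
Definition fln (F : finFieldType) (g : 'M[F]_3) a b c : line F :=
  ln (invmx g *m (vec3 a b c)^T).

(* With [linf g] as the line at infinity, [aff g x z] is the affine point (x, z),
   [inf g s] the point at infinity of slope [s], and [vtx g] the vertical one.
   Locked, since unification would otherwise try to identify points or lines of
   different kinds by computing in [F]. *)
HB.lock Definition aff (F : finFieldType) (g : 'M[F]_3) x z := fpt g 1 x z.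
HB.lock Definition inf (F : finFieldType) (g : 'M[F]_3) s := fpt g 0 1 s.
HB.lock Definition vtx (F : finFieldType) (g : 'M[F]_3) := fpt g 0 0 1.
HB.lock Definition linf (F : finFieldType) (g : 'M[F]_3) := fln g 1 0 0.
HB.lock Definition vert (F : finFieldType) (g : 'M[F]_3) x := fln g (- x) 1 0.
HB.lock Definition slant (F : finFieldType) (g : 'M[F]_3) s d := fln g (- d) (- s) 1.

Definition frameE :=
  (aff.unlock, inf.unlock, vtx.unlock, linf.unlock, vert.unlock, slant.unlock).
Section Frames.
Variable F : finFieldType.
Implicit Types (P : point F) (l m : line F) (g : 'M[F]_3).
Implicit Types (u : 'rV[F]_3) (v : 'cV[F]_3).

Definition nz3 (x y z : F) := ~~ [&& x == 0, y == 0 & z == 0].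

Section Frame.
Variable g : 'M[F]_3.
Hypothesis ug : g \in unitmx.

Lemma mulg_eq0 u : (u *m g == 0) = (u == 0).
Proof. by apply/eqP/eqP => [e|->]; rewrite ?mul0mx // -(mulmxK ug u) e mul0mx. Qed.

Lemma gmul_eq0 v : (invmx g *m v == 0) = (v == 0).
Proof. by apply/eqP/eqP => [e|->]; rewrite ?mulmx0 // -(mulKVmx ug v) e mulmx0. Qed.

Lemma on_fln x y z a b c : nz3 x y z -> nz3 a b c ->
  (fpt g x y z \in points_on (fln g a b c)) = (x * a + y * b + z * c == 0).
Proof.
move=> p0 l0; rewrite on_ln ?mulg_eq0 ?gmul_eq0 ?trmx_eq0 ?vec3_eq0 //.
by rewrite mulmxA mulmxK // vec3_tr.
Qed.

Lemma fpt_eqP x y z x' y' z' : nz3 x y z -> nz3 x' y' z' ->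
  reflect (exists2 k, k != 0 & [/\ x = k * x', y = k * y' & z = k * z'])
    (fpt g x y z == fpt g x' y' z').
Proof.
move=> p0 p0'; apply: (iffP (pt_eqP _ _)); rewrite ?mulg_eq0 ?vec3_eq0 //.
  by move=> [k k0 e]; exists k => //; apply: vec3_inj; rewrite -vec3Z;
    apply: (can_inj (mulmxK ug)); rewrite e scalemxAl.
by move=> [k k0 [-> -> ->]]; exists k; rewrite // scalemxAl vec3Z.
Qed.

Lemma fpt_scale k x y z : k != 0 -> nz3 x y z ->
  fpt g (k * x) (k * y) (k * z) = fpt g x y z.
Proof.
move=> k0 p0; apply/eqP/fpt_eqP => //; last by exists k.
by move: p0; rewrite /nz3 !mulf_eq0 (negbTE k0).
Qed.

Lemma fpt_surj P : exists x y z, nz3 x y z /\ P = fpt g x y z.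
Proof.
have [u u0 ->] := pt_surj P; have := vec3E (u *m invmx g) => e.
exists ((u *m invmx g) 0 0), ((u *m invmx g) 0 1), ((u *m invmx g) 0 2%:R).
by rewrite /nz3 -vec3_eq0 -mulg_eq0 /fpt -e mulmxKV.
Qed.

Lemma fln_surj l : exists a b c, nz3 a b c /\ l = fln g a b c.
Proof.
have [v v0 ->] := ln_surj l; have := vec3E (g *m v)^T => e.
exists ((g *m v)^T 0 0), ((g *m v)^T 0 1), ((g *m v)^T 0 2%:R).
by rewrite /nz3 -vec3_eq0 -trmx_eq0 -gmul_eq0 /fln -e trmxK mulKmx.
Qed.

Lemma fln_scale k a b c : k != 0 -> fln g (k * a) (k * b) (k * c) = fln g a b c.
Proof.
move=> k0; have [e|l0] := eqVneq (vec3 a b c) 0.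
  by move/eqP: e; rewrite vec3_eq0 => /and3P[/eqP-> /eqP-> /eqP->]; rewrite !mulr0.
by rewrite /fln -vec3Z linearZ -scalemxAr ln_scale // gmul_eq0 trmx_eq0.
Qed.

Local Notation aff := (aff g).
Local Notation inf := (inf g).
Local Notation vtx := (vtx g).
Local Notation linf := (linf g).
Local Notation vert := (vert g).
Local Notation slant := (slant g).

Let nz1 x z : nz3 1 x z. Proof. by rewrite /nz3 oner_eq0. Qed.
Let nz01 x z : nz3 x 1 z. Proof. by rewrite /nz3 oner_eq0 andbF. Qed.
Let nz001 x y : nz3 x y 1. Proof. by rewrite /nz3 oner_eq0 !andbF. Qed.

Variant frame_spec : point F -> Prop :=
  | FrameAff x z : frame_spec (aff x z)
  | FrameInf s : frame_spec (inf s)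
  | FrameVtx : frame_spec vtx.

Lemma frameP P : frame_spec P.
Proof.
have [x [y [z [nz ->]]]] := fpt_surj P.
have [x0|x0] := eqVneq x 0; last first.
  rewrite -(@fpt_scale x^-1) ?invr_neq0 // mulVf //.
  by have := FrameAff (x^-1 * y) (x^-1 * z); rewrite aff.unlock.
have [y0|y0] := eqVneq y 0; last first.
  rewrite -(@fpt_scale y^-1) ?invr_neq0 // mulVf // x0 mulr0.
  by have := FrameInf (y^-1 * z); rewrite inf.unlock.
have z0 : z != 0 by move: nz; rewrite /nz3 x0 y0 eqxx.
rewrite -(@fpt_scale z^-1) ?invr_neq0 // mulVf // x0 y0 mulr0.
by have := FrameVtx; rewrite vtx.unlock.
Qed.

Variant frame_line_spec : line F -> Prop :=
  | FrameLinf : frame_line_spec linf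
  | FrameVert x : frame_line_spec (vert x)
  | FrameSlant s d : frame_line_spec (slant s d).

Lemma frame_lineP l : frame_line_spec l.
Proof.
have [a [b [c [nz ->]]]] := fln_surj l.
have [c0|c0] := eqVneq c 0; last first.
  rewrite -(@fln_scale c^-1) ?invr_neq0 // mulVf //.
  have := FrameSlant (- (c^-1 * b)) (- (c^-1 * a)).
  by rewrite slant.unlock !opprK.
have [b0|b0] := eqVneq b 0; last first.
  rewrite -(@fln_scale b^-1) ?invr_neq0 // mulVf // c0 mulr0.
  have := FrameVert (- (b^-1 * a)); by rewrite vert.unlock opprK.
have a0 : a != 0 by move: nz; rewrite /nz3 c0 b0 eqxx !andbT.
rewrite -(@fln_scale a^-1) ?invr_neq0 // mulVf // c0 b0 mulr0.
by have := FrameLinf; rewrite linf.unlock.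
Qed.

Lemma aff_eq x z x' z' : (aff x z == aff x' z') = (x == x') && (z == z').
Proof.
rewrite !frameE; apply/fpt_eqP/andP => // [[k _ [/esym]]|[/eqP-> /eqP->]].
  by rewrite mulr1 => ->; rewrite !mul1r => -> ->.
by exists 1; rewrite ?oner_eq0 // !mul1r.
Qed.

Lemma inf_eq s s' : (inf s == inf s') = (s == s').
Proof.
rewrite !frameE; apply/fpt_eqP/eqP => // [[k _ [_ /esym]]|->].
  by rewrite mulr1 => ->; rewrite mul1r.
by exists 1; rewrite ?oner_eq0 // !mul1r.
Qed.

Lemma aff_on_linf x z : (aff x z \in points_on linf) = false.
Proof. by rewrite !frameE on_fln // !mulr0 !addr0 mulr1 oner_eq0. Qed.

Lemma inf_on_linf s : inf s \in points_on linf.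
Proof. by rewrite !frameE on_fln // !mulr0 mul0r !addr0. Qed.

Lemma vtx_on_linf : vtx \in points_on linf.
Proof. by rewrite !frameE on_fln // !mulr0 mul0r !addr0. Qed.

Lemma aff_on_vert x z x' : (aff x z \in points_on (vert x')) = (x == x').
Proof. by rewrite !frameE on_fln // mulr0 addr0 mul1r mulr1 addrC subr_eq0. Qed.

Lemma inf_on_vert s x : (inf s \in points_on (vert x)) = false.
Proof. by rewrite !frameE on_fln // mulr0 mul0r addr0 add0r mulr1 oner_eq0. Qed.

Lemma vtx_on_vert x : vtx \in points_on (vert x).
Proof. by rewrite !frameE on_fln // !mul0r mulr0 !addr0. Qed.

Lemma aff_on_slant x z s d : (aff x z \in points_on (slant s d)) = (z == s * x + d).
Proof.
by rewrite !frameE on_fln // mul1r mulr1 mulrN addrC -opprD subr_eq0 addrC (mulrC s).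
Qed.

Lemma inf_on_slant s' s d : (inf s' \in points_on (slant s d)) = (s' == s).
Proof. by rewrite !frameE on_fln // mul0r add0r mul1r mulr1 addrC subr_eq0. Qed.

Lemma vtx_on_slant s d : (vtx \in points_on (slant s d)) = false.
Proof. by rewrite !frameE on_fln // !mul0r !add0r mulr1 oner_eq0. Qed.

End Frame.

(* An elation with centre [vtx g] permutes the lines [slant s d] of each slope
   [s], so that its effect on one affine point determines it. *)
Lemma elation_shift g s : g \in unitmx -> elation (linf g) (vtx g) s ->
  exists t, forall x z, s (aff g x z) = aff g x (z + t).
Proof.
move=> ug /and4P[_ /forallP coll /forallP fix_l /forallP fix_m].
have fixl P : P \in points_on (linf g) -> s P = P.
  by move=> lP; apply/eqP; move/implyP: (fix_l P); apply.
have saff x z : exists z', s (aff g x z) = aff g x z'.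
  have := fix_m (vert g x); rewrite (vtx_on_vert ug) /= => /eqP e.
  have on_v : s (aff g x z) \in points_on (vert g x).
    by rewrite -e imset_f // aff_on_vert.
  have off : s (aff g x z) \notin points_on (linf g).
    apply/negP => on_l; have := aff_on_linf ug x z.
    by rewrite -(perm_inj (fixl _ on_l)) on_l.
  case: (frameP ug (s (aff g x z))) on_v off => [x' z'|d|].
  - by rewrite (aff_on_vert ug) => /eqP-> _; exists z'.
  - by rewrite (inf_on_linf ug).
  - by rewrite (vtx_on_linf ug).
have lift_shift d d0 : s (aff g 0 d) = aff g 0 d0 ->
    forall a x, s (aff g x (a * x + d)) = aff g x (a * x + d0).
  move=> sd a x; have /existsP[m /eqP e] := coll (slant g a d).
  have on_m P : P \in points_on (slant g a d) -> s P \in points_on m.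
    by move=> aP; rewrite -e imset_f.
  have := on_m (inf g a); rewrite (inf_on_slant ug) eqxx (fixl _ (inf_on_linf ug _)) => /(_ isT).
  have := on_m (aff g 0 d); rewrite (aff_on_slant ug) mulr0 add0r eqxx sd => /(_ isT).
  have := on_m (aff g x (a * x + d)); rewrite (aff_on_slant ug) eqxx => /(_ isT).
  case: (frame_lineP ug m) => [|x'|a' d'].
  - by rewrite (aff_on_linf ug).
  - by rewrite (inf_on_vert ug).
  have [z' ->] := saff x (a * x + d).
  rewrite !(aff_on_slant ug) (inf_on_slant ug) mulr0 add0r.
  by move=> /eqP-> /eqP<- /eqP<-.
have [t s0] := saff 0 0; exists t => x z.
have shift x' a : s (aff g x' (a * x')) = aff g x' (a * x' + t).
  by have := lift_shift _ _ s0 a x'; rewrite addr0.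
(* A point with [x != 0] lies on a slanted line through the origin. A point [(0, z)] is compared
   with [(1, z)] along the line of slope 0. *)
have [->|x0] := eqVneq x 0; last by rewrite -{1 2}(divfK x0 z) shift.
have [z' s0z] := saff 0 z; rewrite s0z.
have := lift_shift _ _ s0z 0 1; rewrite mul0r !add0r.
have := shift 1 z; rewrite mulr1 => -> /eqP; rewrite (aff_eq ug) => /andP[_ /eqP->].
by [].
Qed.

End Frames.

(** * Existence and change of frames, and the pencil count *)

Section FrameExistence.
Variable F : finFieldType.
Implicit Types (P : point F) (l m : line F) (g : 'M[F]_3).
Implicit Types (u : 'rV[F]_3) (v : 'cV[F]_3).

Lemma rows3_unit r0 r1 r2 :
  (forall x y z, x *: r0 + y *: r1 + z *: r2 = 0 -> [/\ x = 0, y = 0 & z = 0]) ->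
  @rows3 F r0 r1 r2 \in unitmx.
Proof.
move=> free; rewrite -row_free_unit; apply: inj_row_free => u.
rewrite (vec3E u) vec3_rows3 => /free[-> -> ->].
by apply/eqP; rewrite vec3_eq0 !eqxx.
Qed.

(** The rows of the frame are a point of [m] off [l], a point of [l] off [m], and the common point
    of [l] and [m]. *)
Lemma frame_exists l m : l != m ->
  exists g, [/\ g \in unitmx, l = linf g & m = vert g 0].
Proof.
have [v v0 ->] := ln_surj l; have [v' v0' ->] := ln_surj m => ne.
have [r0 r0v r0v'] := ln_neq v0 v0' ne.
rewrite eq_sym in ne; have [r1 r1v' r1v] := ln_neq v0' v0 ne.
have [r2 r2_0 [r2v r2v']] : exists2 r2 : 'rV[F]_3, r2 != 0 & r2 *m v = 0 /\ r2 *m v' = 0.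
  pose K := kermx (row_mx v v').
  have K0 : nz_row K != 0.
    rewrite nz_row_eq0 -mxrank_eq0 mxrank_ker subn_eq0 -ltnNge.
    by apply: leq_ltn_trans (rank_leq_col _) _.
  exists (nz_row K) => //; have : nz_row K *m row_mx v v' = 0.
    by apply/eqP; rewrite -sub_kermx nz_row_sub.
  by rewrite mul_mx_row -[X in _ = X]row_mx0 => /eq_row_mx.
have g_free x y z : x *: r0 + y *: r1 + z *: r2 = 0 -> [/\ x = 0, y = 0 & z = 0].
  move=> e; have := congr1 (mulmxr v) e; have := congr1 (mulmxr v') e; move: e.
  rewrite /= !mulmxDl -!scalemxAl r0v r0v' r1v r1v' r2v r2v' !scaler0 !addr0 !add0r.
  rewrite !mul0mx => e /matrixP/(_ 0 0); rewrite !mxE mulr1 => y0.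
  move=> /matrixP/(_ 0 0); rewrite !mxE mulr1 => x0; split=> //.
  move/eqP: e; rewrite x0 y0 !scale0r !add0r scaler_eq0 (negbTE r2_0) orbF.
  by move/eqP.
have ug := rows3_unit g_free; exists (rows3 r0 r1 r2).
have rowsE w a b c : r0 *m w = a%:M -> r1 *m w = b%:M -> r2 *m w = c%:M ->
    w = invmx (rows3 r0 r1 r2) *m (vec3 a b c)^T.
  move=> e0 e1 e2; rewrite -[LHS](mulKmx ug); congr (_ *m _).
  apply/row_matrixP => i; rewrite row_mul rowK; apply/rowP => j; rewrite !ord1.
  by case: i => -[|[|[|//]]] lt_i /=; rewrite ?e0 ?e1 ?e2 !mxE eqxx mulr1n.
have z11 : 0 = 0%:M :> 'M[F]_1 by rewrite -scalemx1 scale0r.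
split; first exact: ug.
  by rewrite linf.unlock; congr (ln _); apply: (rowsE v 1 0 0 r0v); rewrite ?r1v ?r2v z11.
rewrite vert.unlock oppr0; congr (ln _).
by apply: (rowsE v' 0 1 0 _ r1v'); rewrite ?r0v' ?r2v' z11.
Qed.

Lemma frame_change g (m x0 k f d : F) : g \in unitmx -> m != 0 -> k != 0 ->
  exists g', [/\ g' \in unitmx, vtx g' = vtx g
    & forall a b, aff g' a b = aff g (m * a + x0) (k * b + f * a + d)].
Proof.
move=> ug m0 k0; pose n := rows3 (vec3 1 x0 d) (vec3 0 m f) (vec3 0 0 k).
have nE x y z : vec3 x y z *m n = vec3 x (m * y + x0 * x) (k * z + f * y + d * x).
  rewrite vec3_rows3 !vec3Z; apply/rowP => j; rewrite !mxE.
  by case: j => -[|[|[|//]]] lt_j /=; ring.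
have un : n \in unitmx.
  rewrite -row_free_unit; apply: inj_row_free => u.
  rewrite (vec3E u) nE => /eqP; rewrite vec3_eq0 => /and3P[/eqP-> /eqP + /eqP].
  rewrite !mulr0 !addr0 => /eqP; rewrite mulf_eq0 (negbTE m0) => /eqP->.
  rewrite mulr0 addr0 => /eqP; rewrite mulf_eq0 (negbTE k0) => /eqP->.
  by apply/eqP; rewrite vec3_eq0 !eqxx.
exists (n *m g); rewrite unitmx_mul un ug; split=> // [|a b].
  rewrite vtx.unlock /fpt mulmxA nE !(mulr0, mulr1, addr0).
  have -> : vec3 0 0 k = vec3 (k * 0) (k * 0) (k * 1) by rewrite mulr0 mulr1.
  by apply: (@fpt_scale _ g ug k 0 0 1 k0); rewrite /nz3 oner_eq0 !andbF.
by rewrite aff.unlock /fpt mulmxA nE !mulr1.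
Qed.

Lemma perm_of_mx (M : 'M[F]_3) : M \in unitmx ->
  exists2 s : {perm point F}, s \in PGL3 F & forall u, u != 0 -> s (pt u) = pt (u *m M).
Proof.
move=> uM; pose f P : point F := insubd P <<val P *m M>>%MS.
have uM0 u : u != 0 -> u *m M != 0.
  by apply: contraNneq => e; rewrite -(mulmxK uM u) e mul0mx.
have f_pt u : u != 0 -> f (pt u) = pt (u *m M).
  move=> u0; have e : <<val (pt u) *m M>>%MS = <<u *m M>>%MS.
    by apply/eq_genmx; rewrite val_pt //; exact: eqmxMr (genmxE u).
  apply: val_inj; rewrite /f e val_pt ?uM0 // insubdK //.
  by have := is_subsp_genmx (u *m M); rewrite rank_rV uM0.
have f_inj : injective f.
  move=> P Q; have [u u0 ->] := pt_surj P; have [w w0 ->] := pt_surj Q.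
  rewrite !f_pt // => /eqP/pt_eqP; case=> [||k k0 e]; rewrite ?uM0 //.
  apply/eqP/pt_eqP => //; exists k => //.
  by apply: (can_inj (mulmxK uM)); rewrite e scalemxAl.
exists (perm f_inj) => [|u u0]; last by rewrite permE f_pt.
rewrite inE; apply/existsP; exists M; rewrite uM; apply/forallP => P.
have [u u0 ->] := pt_surj P; rewrite permE f_pt // !val_pt ?uM0 //.
by rewrite !genmxE !(eqmxMr M (genmxE u)) submx_refl.
Qed.

Section Pencil.
Variable g : 'M[F]_3.
Hypothesis ug : g \in unitmx.
Implicit Type A : {set point F}.

(** The lines through [(x, z)] partition the other points, while [(x, z)] itself is counted once on
    each of the [q] slanted lines in addition to the vertical one. *)
Lemma pencil_count A (x z : F) : aff g x z \in A ->
  (#|A| + #|F| = #|A :&: points_on (vert g x)| +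
    \sum_s #|A :&: points_on (slant g s (z - s * x))|)%N.
Proof.
move=> AP; rewrite -(cardsID (points_on (vert g x)) A) -addnA; congr addn.
set B := A :\: _.
have slantE s : #|A :&: points_on (slant g s (z - s * x))| =
    (#|B :&: points_on (slant g s (z - s * x))| + 1)%N.
  rewrite (cardsD1 (aff g x z)) inE AP (aff_on_slant ug) addrC subrK eqxx addnC.
  congr (_ + _)%N; apply: eq_card => Q; rewrite in_setD1 !in_setI in_setD.
  case: (frameP ug Q) => [x' z'|s'|].
  - rewrite (aff_eq ug) (aff_on_vert ug) (aff_on_slant ug).
    have [->|_] := eqVneq x' x; last by rewrite andbA.
    by rewrite addrC subrK /=; case: eqVneq; rewrite ?andbF.
  - rewrite (inf_on_vert ug) /= andbA.
    suff -> : inf g s' != aff g x z by [].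
    by apply: contraFneq (aff_on_linf ug x z) => <-; rewrite (inf_on_linf ug).
  - by rewrite (vtx_on_slant ug) !andbF.
under eq_bigr do rewrite slantE; rewrite big_split /= sum1_card; congr addn.
have cardE s : #|B :&: points_on (slant g s (z - s * x))| =
    (\sum_(Q in B) (Q \in points_on (slant g s (z - s * x))))%N.
  rewrite -sum1_card big_mkcond [RHS]big_mkcond /=; apply: eq_bigr => Q _.
  by rewrite in_setI; case: (Q \in B) => //=; case: (Q \in _).
under eq_bigr do rewrite cardE; rewrite exchange_big /= -sum1_card.
apply: eq_bigr => Q; rewrite in_setD => /andP[].
case: (frameP ug Q) => [x' z'|s'|]; last by rewrite vtx_on_vert.
  rewrite (aff_on_vert ug) => x'x _.
  have dx : x' - x != 0 by rewrite subr_eq0.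
  rewrite (bigD1 ((z' - z) / (x' - x))) //= (aff_on_slant ug) addrCA -mulrBr divfK //.
  rewrite [z + _]addrC subrK eqxx big1 // => s; rewrite (aff_on_slant ug) => ne.
  case: eqVneq => // z'E; move: ne; rewrite z'E.
  by rewrite addrCA -mulrBr [z + _]addrC addrK mulfK ?eqxx.
move=> _ _; rewrite (bigD1 s') //= (inf_on_slant ug) eqxx big1 // => s.
by rewrite (inf_on_slant ug) eq_sym => /negbTE->.
Qed.

End Pencil.

End FrameExistence.

(** * Elation arcs *)

Section ArcFrame.
Variables (F : finFieldType) (h : nat).
Hypothesis cardF : #|F| = (2 ^ h)%N.
Let ch2 : 2 \in [pchar F] := card_finPcharP cardF isT.
Variable A : {set point F}.
Implicit Types (P Q R : point F) (l m : line F) (g : 'M[F]_3) (H : {set F}).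

(* [H] is the group of vertical translations that stabilise the arc. *)
Definition arc_frame g H :=
  [/\ g \in unitmx, addr_closed H, #|F| = (4 * #|H|)%N & #|A| = (#|F| + #|H|)%N] /\
  [/\ forall x z z', aff g x z \in A -> (aff g x z' \in A) = (z + z' \in H),
      forall s d, #|A :&: points_on (slant g s d)| \in [:: 0; 2]%N,
      vtx g \notin A & (#|A :&: points_on (linf g)| <= #|H|)%N].

(** An orbit of [H] has at least 2 elements and fills a whole vertical [t]-secant. A pencil count
    then shows that no slanted line is a [t]-secant when [t > 2]. *)
Lemma arc_frame_of_shift g H :
  g \in unitmx -> addr_closed H -> #|F| = (4 * #|H|)%N -> (1 < #|H|)%N ->
  km_arc #|H| A ->
  (forall x z t, t \in H -> aff g x z \in A -> aff g x (z + t) \in A) ->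
  arc_frame g H.
Proof.
move=> ug clH cFH H2 [cA secA _] shiftA; set t := #|H| in cFH H2 cA secA *.
have [H0 HD] := clH.
have secP l : [\/ #|A :&: points_on l| = 0%N, #|A :&: points_on l| = 2%N
      | #|A :&: points_on l| = t].
  by have := secA l; rewrite !inE => /or3P[] /eqP->;
    [constructor 1 | constructor 2 | constructor 3].
have colE x z : aff g x z \in A ->
    A :&: points_on (vert g x) = [set aff g x (z + r) | r in H].
  move=> Axz; apply/esym/eqP; rewrite eqEcard; apply/andP; split.
    apply/subsetP => _ /imsetP[r Hr ->].
    by rewrite in_setI (shiftA _ _ _ Hr Axz) (aff_on_vert ug) eqxx.
  rewrite card_imset; last first.
    by move=> r r' /eqP; rewrite (aff_eq ug) eqxx => /eqP/addrI.
  by have [->|->|->] := secP (vert g x).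
have aff_in x z : aff g x z \in A -> #|A :&: points_on (vert g x)| = t.
  move=> Axz; rewrite (colE _ _ Axz) card_imset //.
  by move=> r r' /eqP; rewrite (aff_eq ug) eqxx => /eqP/addrI.
have [x0 [z0 A0]] : exists x z, aff g x z \in A.
  have : (#|A :&: points_on (linf g)| < #|A|)%N.
    by rewrite cA cFH; have [->|->|->] := secP (linf g); lia.
  rewrite -(cardsID (points_on (linf g)) A) -{1}[#|_|]addn0 ltn_add2l card_gt0.
  case/set0Pn => Q; rewrite in_setD => /andP[].
  case: (frameP ug Q) => [x z _ ?|d|]; first by exists x, z.
    by rewrite (inf_on_linf ug).
  by rewrite (vtx_on_linf ug).
have vtxA : vtx g \notin A.
  apply/negP => vA; have : vtx g \in A :&: points_on (vert g x0).
    by rewrite in_setI vA (vtx_on_vert ug).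
  rewrite (colE _ _ A0) => /imsetP[r _ e]; have := aff_on_linf ug x0 (z0 + r).
  by rewrite -e (vtx_on_linf ug).
split=> //; split=> // [x z z' Axz|s d|]; last first.
- by have [->|->|->] := secP (linf g); lia.
- have [->|->|secE] := secP (slant g s d); rewrite ?inE ?eqxx ?orbT // secE.
  have [->//|t2] := eqVneq t 2%N; exfalso.
  have t_gt2 : (2 < t)%N by rewrite ltn_neqAle eq_sym t2.
  have [x [Ax]] : exists x, aff g x (s * x + d) \in A.
    have : (0 < #|A :&: points_on (slant g s d) :\ inf g s|)%N.
      rewrite -(ltn_add2l 1) addn0; apply: leq_trans H2 _.
      by rewrite -{1}secE (cardsD1 (inf g s)) leq_add2r leq_b1.
    rewrite card_gt0 => /set0Pn[Q]; rewrite in_setD1 in_setI => /and3P[].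
    case: (frameP ug Q) => [x z|d'|] ne AQ.
    + by rewrite (aff_on_slant ug) => /eqP zE; exists x; rewrite -zE.
    + by rewrite (inf_on_slant ug) => /eqP d's; rewrite d's eqxx in ne.
    + by rewrite (vtx_on_slant ug).
  (* Two [t]-secants and [q - 1] lines with at least 2 points each would give
     [2q + t >= 2t + 2(q - 1)], contrary to [t > 2]. *)
  have := pencil_count ug Ax; rewrite (aff_in _ _ Ax) cA (bigD1 s) //=.
  rewrite addrAC addrN add0r secE; set S := (X in (_ = _ + (_ + X))%N) => cnt.
  have : (\sum_(s' | s' != s) 2 <= S)%N.
    apply: leq_sum => s' _.
    have : aff g x (s * x + d) \in A :&: points_on (slant g s' (s * x + d - s' * x)).
      by rewrite in_setI Ax (aff_on_slant ug) [X in _ == X]addrC subrK eqxx.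
    have [/eqP|->|->] := secP (slant g s' (s * x + d - s' * x)) => //.
    by rewrite cards_eq0 => /eqP->; rewrite inE.
  rewrite sum_nat_const cardC1; move: S cnt => S cnt S2.
  by move: #|F| cFH cnt S2 t_gt2 => q; lia.
apply/idP/idP => [Axz'|Hr]; last first.
  by have := shiftA _ _ _ Hr Axz; rewrite addKx.
have : aff g x z' \in A :&: points_on (vert g x).
  by rewrite in_setI Axz' (aff_on_vert ug) eqxx.
rewrite (colE _ _ Axz) => /imsetP[r Hr /eqP]; rewrite (aff_eq ug) => /andP[_ /eqP->].
by rewrite addKx.
Qed.

Lemma frame_of_line l : exists2 g, g \in unitmx & l = linf g.
Proof.
have u1 := unitmx1 F 3.
have [m ml] : exists m, l != m.
  have [e|ne] := eqVneq l (linf 1%:M); last by exists (linf 1%:M).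
  exists (vert 1%:M 0); rewrite e; apply: contraTneq (inf_on_linf u1 0) => ->.
  by rewrite (inf_on_vert u1).
by have [g [ug lE _]] := frame_exists ml; exists g.
Qed.

Lemma frame_through l R : R \in points_on l ->
  exists g, [/\ g \in unitmx, l = linf g & R = vtx g].
Proof.
move=> lR; have [g ug lE] := frame_of_line l; rewrite lE in lR.
case: (frameP ug R) lR => [x z|s|] lR; last by exists g.
  by rewrite (aff_on_linf ug) in lR.
have ne : l != slant g s 0.
  rewrite lE; apply: contraTneq (vtx_on_linf ug) => ->.
  by rewrite (vtx_on_slant ug).
have [g' [ug' lE' mE']] := frame_exists ne; exists g'; split=> //.
have : inf g s \in points_on (slant g s 0) by rewrite (inf_on_slant ug).
rewrite mE'; rewrite -lE lE' in lR.
case: (frameP ug' (inf g s)) lR => [x z|d|] //.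
  by rewrite (aff_on_linf ug').
by rewrite (inf_on_vert ug').
Qed.

Lemma elations_stabP l s : s \in elations_stab l A ->
  (exists R, elation l R s) /\ forall P, P \in A -> s P \in A.
Proof.
rewrite inE => /andP[/existsP eR /eqP sA]; split=> // P AP.
by rewrite -sA imset_f.
Qed.

Lemma elation_fix l R s P : elation l R s -> P \in points_on l -> s P = P.
Proof.
by case/and4P=> _ _ /forallP/(_ P)/implyP fixl _ /fixl/eqP.
Qed.

Lemma elation_stable l R s m P : elation l R s -> R \in points_on m ->
  P \in points_on m -> s P \in points_on m.
Proof.
case/and4P=> _ _ _ /forallP/(_ m)/implyP stab /stab/eqP e mP.
by rewrite -e imset_f.
Qed.

(** For [t = 2] the frame is put at the centre of the given elation. For [t > 2] a [t]-secant
    through an arc point off the elation line is made vertical, and transitivity on it yields [t]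
    translations. *)
Lemma arc_frame_exists : (8 <= #|F|)%N -> elation_km_arc (#|F| %/ 4) A ->
  exists g H, arc_frame g H /\ km_arc (#|F| %/ 4) A.
Proof.
move=> q8 [l [arcA trans2 nontriv]].
have cFt : #|F| = (4 * (#|F| %/ 4))%N.
  rewrite mulnC divnK //; move: q8; rewrite cardF.
  by case: (h) => [|[|k]] // _; rewrite !expnS mulnA dvdn_mulr.
set t := (#|F| %/ 4)%N in arcA trans2 nontriv cFt *.
have t2 : (1 < t)%N by lia.
suff [g [H [ug clH cH shiftA]]] : exists g H, [/\ g \in unitmx, addr_closed H, #|H| = t
    & forall x z r, r \in H -> aff g x z \in A -> aff g x (z + r) \in A].
  by exists g, H; split=> //; apply: arc_frame_of_shift; rewrite ?cH.
have [cA secA _] := arcA.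
have [t_eq2|t_neq2] := eqVneq t 2%N.
  have [s sA s1] := nontriv t_eq2; have [[R elR] stabA] := elations_stabP sA.
  have lR : R \in points_on l by case/and4P: elR.
  have [g [ug lE RE]] := frame_through lR; rewrite lE RE in elR.
  have [r sE] := elation_shift ug elR; exists g, [set 0; r]; split=> //.
  - split=> [|u v]; first by rewrite !inE eqxx.
    by rewrite !inE => /orP[] /eqP-> /orP[] /eqP->;
      rewrite ?addr0 ?add0r ?addxx // eqxx ?orbT.
  - rewrite cards2 t_eq2; case: eqVneq => // r0; case/eqP: s1.
    apply/permP => P; rewrite perm1; case: (frameP ug P) => [x z|d|].
    + by rewrite sE -r0 addr0.
    + exact: elation_fix elR (inf_on_linf ug d).
    + exact: elation_fix elR (vtx_on_linf ug).
  - move=> x z r'; rewrite !inE => /orP[] /eqP->; first by rewrite addr0.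
    by rewrite -sE; exact: stabA.
have t_gt2 : (2 < t)%N by lia.
have [P AP lP] : exists2 P, P \in A & P \notin points_on l.
  have : (#|A :&: points_on l| < #|A|)%N.
    by have := secA l; rewrite cA cFt !inE => /or3P[] /eqP->; lia.
  rewrite -(cardsID (points_on l) A) -{1}[#|_|]addn0 ltn_add2l card_gt0.
  by case/set0Pn => Q; rewrite in_setD => /andP[lQ AQ]; exists Q.
(* If all lines through [P] were 2-secants, the pencil count would read [2q + t = 2 + 2q]. *)
have [m mP cm] : exists2 m, P \in points_on m & #|A :&: points_on m| = t.
  have [g ug lE] := frame_of_line l; rewrite lE in lP.
  case: (frameP ug P) AP lP => [x z|d|]; rewrite ?(inf_on_linf ug) ?(vtx_on_linf ug) //.
  move=> AP _; have sec2 n : aff g x z \in points_on n -> #|A :&: points_on n| != t ->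
      #|A :&: points_on n| = 2%N.
    move=> nP nt; have := secA n; rewrite !inE (negbTE nt) orbF => /orP[|/eqP//].
    by rewrite cards_eq0 => /eqP e; have := in_set0 (aff g x z); rewrite -e in_setI AP nP.
  have [cv|cv] := eqVneq #|A :&: points_on (vert g x)| t.
    by exists (vert g x); rewrite ?(aff_on_vert ug).
  have on_s s : aff g x z \in points_on (slant g s (z - s * x)).
    by rewrite (aff_on_slant ug) [X in _ == X]addrC subrK.
  have [/existsP[s /eqP cs]|] :=
    boolP [exists s, #|A :&: points_on (slant g s (z - s * x))| == t].
    by exists (slant g s (z - s * x)).
  rewrite negb_exists => /forallP no_s; have := pencil_count ug AP.
  rewrite sec2 ?(aff_on_vert ug) //; under eq_bigr => s _ do rewrite sec2 //.
  by rewrite sum_nat_const cA cFt; lia.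
have lm : l != m by apply: contraNneq lP => ->.
have [g [ug lE mE]] := frame_exists lm.
rewrite lE in lP trans2 nontriv; rewrite mE in mP cm.
case: (frameP ug P) AP lP mP => [x z|d|]; rewrite ?(inf_on_linf ug) ?(vtx_on_linf ug) //.
rewrite (aff_on_vert ug) => AP _ /eqP x0; rewrite {x}x0 in AP.
pose H := [set r | [forall x, forall z, (aff g x z \in A) ==> (aff g x (z + r) \in A)]].
have HP r : reflect (forall x z, aff g x z \in A -> aff g x (z + r) \in A) (r \in H).
  rewrite inE; apply: (iffP forallP) => Hr x.
    by move=> z'; apply/implyP; move/forallP: (Hr x).
  by apply/forallP => z'; apply/implyP; exact: Hr.
exists g, H; split=> //; last by move=> x z' r /HP; apply.
  split=> [|u v /HP Hu /HP Hv]; apply/HP => x z' Axz; first by rewrite addr0.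
  by rewrite addrA; apply/Hv/Hu.
(* The orbit of [P] under [H] is shown to be the whole arc part of the vertical [t]-secant. *)
rewrite -cm -(card_imset (pred_of_set H) (f := fun r => aff g 0 (z + r))); last first.
  by move=> r r' /eqP; rewrite (aff_eq ug) eqxx => /eqP/addrI.
apply: eq_card => Q; rewrite in_setI; apply/imsetP/andP => [[r /HP Hr ->]|[AQ mQ]].
  by rewrite Hr // (aff_on_vert ug) eqxx.
have ml : vert g 0 != linf g by rewrite -mE eq_sym -lE.
have AmP : aff g 0 z \in A :&: points_on (vert g 0).
  by rewrite in_setI AP (aff_on_vert ug) eqxx.
have AmQ : Q \in A :&: points_on (vert g 0) by rewrite in_setI AQ.
have [s sA sP] := trans2 t_gt2 _ cm ml _ _ AmP AmQ.
have [[R elR] stabA] := elations_stabP sA.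
have lQ : Q \notin points_on (linf g).
  apply/negP => lQ; have := elation_fix elR lQ; rewrite -{2}sP => /perm_inj e.
  by rewrite e (aff_on_linf ug) in lQ.
case: (frameP ug Q) mQ lQ sP {AQ AmQ} => [x z'|d|]; last by rewrite (vtx_on_linf ug).
  rewrite (aff_on_vert ug) => /eqP-> _ sP.
  have lR : R \in points_on (linf g) by case/and4P: elR.
  (* An elation with centre [inf g d] stabilises the line of slope [d] through [P], which meets the
     vertical line only in [P]. Hence [Q = P], and the shift 0 serves. *)
  case: (frameP ug R) lR elR => [x' z2|d|] lR elR; first by rewrite (aff_on_linf ug) in lR.
    have := @elation_stable _ _ _ (slant g d z) (aff g 0 z) elR.
    rewrite sP (inf_on_slant ug) !(aff_on_slant ug) mulr0 add0r !eqxx => /(_ isT isT) /eqP->.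
    by exists 0; rewrite ?addr0 //; apply/HP => x'' z''; rewrite addr0.
  have [r sE] := elation_shift ug elR; exists r; last by rewrite -sE.
  by apply/HP => x' z2 /stabA; rewrite sE.
by rewrite (inf_on_vert ug).
Qed.

End ArcFrame.

(** * From an arc frame to the normal form *)

Section Classification.
Variables (F : finFieldType) (h : nat).
Hypothesis cardF : #|F| = (2 ^ h)%N.
Let ch2 : 2 \in [pchar F] := card_finPcharP cardF isT.
Variable A : {set point F}.
Implicit Types (P Q R : point F) (l m : line F) (g : 'M[F]_3) (H : {set F}).

Definition normal_frame g (b : F) :=
  [/\ g \in unitmx, b != 0 & b != 1] /\
  [/\ forall u v, (aff g u v \in A) = affine_arc b u v, vtx g \notin A
    & forall s, (inf g s \in A) = ~~ trb s && ~~ trb (b ^+ 2 * s)].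

Lemma card_ge3 (T : finType) (B : {set T}) x y z :
  x \in B -> y \in B -> z \in B -> x != y -> x != z -> y != z -> (2 < #|B|)%N.
Proof.
move=> Bx By Bz xy xz yz; rewrite (cardsD1 x) Bx (cardsD1 y) (cardsD1 z) !inE.
by rewrite By Bz (eq_sym y x) (eq_sym z x) (eq_sym z y) xy xz yz.
Qed.

(** The affine part comes from [affine_normal_form]. It determines the points at infinity, because a
    slanted line through the arc point [(0, 0)] meets the arc in exactly one further point, affine
    or infinite. *)
Lemma normal_frame_exists g H : arc_frame A g H -> exists g' b, normal_frame g' b.
Proof.
case=> -[ug clH cFH cA] [colA secA vtxA linfA]; have [H0 HD] := clH.
pose X := [set x | [exists z, aff g x z \in A]].
pose c x := odflt 0 [pick z | aff g x z \in A].
have affE x z : (aff g x z \in A) = (x \in X) && (z + c x \in H).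
  rewrite inE; have [/existsP ex|] := boolP [exists z', aff g x z' \in A].
    rewrite /c; case: (pickP (fun z => aff g x z \in A)) => [zc Ac|none]; last first.
      by case: ex => z'; rewrite none.
    by rewrite (colA x zc z Ac) addrC.
  by rewrite negb_exists => /forallP/(_ z)/negbTE.
(* At most [t] of the [q + t = 5t] points are at infinity, and each vertical line carries at most
   [t] of the others. *)
have X4 : (4 <= #|X|)%N.
  pose f p := aff g p.1 (c p.1 + p.2).
  have sub : A \subset (A :&: points_on (linf g)) :|: (f @: setX X H).
    apply/subsetP => Q AQ; rewrite in_setU in_setI AQ /=.
    case: (frameP ug Q) AQ => [x z|d|]; last by rewrite (vtx_on_linf ug).
      rewrite affE => /andP[Xx Hz]; apply/orP; right; apply/imsetP.
      exists (x, z + c x); rewrite ?in_setX ?Xx //.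
      by rewrite /f /= addrC -addrA addxx // addr0.
    by rewrite (inf_on_linf ug).
  have H_gt0 : (0 < #|H|)%N by rewrite card_gt0; apply/set0Pn; exists 0.
  rewrite -(leq_pmul2r H_gt0) -(leq_add2l #|H|) -cFH addnC -cA.
  apply: leq_trans (subset_leq_card sub) _; apply: leq_trans (leq_card_setU _ _) _.
  by apply: leq_add linfA _; rewrite -cardsX leq_imset_card.
have nocol x y z : x \in X -> y \in X -> z \in X -> x != y -> x != z -> y != z ->
    forall s d, [&& s * x + d + c x \in H, s * y + d + c y \in H
                  & s * z + d + c z \in H] -> False.
  move=> Xx Xy Xz xy xz yz s d /and3P[Hx Hy Hz].
  have on w : w \in X -> s * w + d + c w \in H ->
      aff g w (s * w + d) \in A :&: points_on (slant g s d).
    by move=> Xw Hw; rewrite in_setI affE Xw Hw (aff_on_slant ug) eqxx.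
  have : (2 < #|A :&: points_on (slant g s d)|)%N.
    by apply: card_ge3 (on _ Xx Hx) (on _ Xy Hy) (on _ Xz Hz) _ _ _;
      rewrite (aff_eq ug) negb_and ?xy ?xz ?yz.
  by have := secA s d; rewrite !inE => /orP[] /eqP->.
have [b [m [x0 [k [f [d [[b0 b1 m0 k0] arcE]]]]]]] :=
  affine_normal_form cardF clH cFH X4 nocol.
have [g' [ug' vtxE affE']] := frame_change x0 f d ug m0 k0.
have arcA u v : (aff g' u v \in A) = affine_arc b u v by rewrite affE' affE arcE.
exists g', b; split=> //; split=> // [|s]; first by rewrite vtxE.
(* Both frames have the same vertical point, so a slanted line of [g'], which misses it, is slanted
   for [g]. *)
have sec s' d' : #|A :&: points_on (slant g' s' d')| \in [:: 0; 2]%N.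
  have := vtx_on_slant ug' s' d'; rewrite vtxE.
  case: (frame_lineP ug (slant g' s' d')) => [|x|a e _]; last exact: secA.
    by rewrite (vtx_on_linf ug).
  by rewrite (vtx_on_vert ug).
have in_slant u : affine_arc b u (s * u) ->
    aff g' u (s * u) \in A :&: points_on (slant g' s 0).
  by move=> arc_u; rewrite in_setI arcA arc_u (aff_on_slant ug') addr0 eqxx.
have arc_bits u v t0 t1 : trb v = t0 -> trb (b * v) = t1 ->
    affine_arc b u v = (u == t0%:R + (b + 1) * t1%:R).
  by move=> <- <-; rewrite /affine_arc !(Tr_trb cardF).
have arc00 : affine_arc b 0 (s * 0).
  by rewrite mulr0 (arc_bits _ _ false false) ?mulr0 ?(trb0 cardF) // addr0.
have sb1 : trb (s * (b + 1)) = trb (b * s) (+) trb s.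
  by rewrite mulrDr mulr1 (trbD cardF) (mulrC s).
have bsb : trb (b * (s * b)) = trb (b ^+ 2 * s) by congr trb; ring.
have bsb1 : trb (b * (s * (b + 1))) = trb (b ^+ 2 * s) (+) trb (b * s).
  by rewrite -(trbD cardF); congr trb; ring.
have V11 : 1 + (b + 1) * 1 = b by rewrite mulr1 addrC addxK.
have V01 : 0 + (b + 1) * 1 = b + 1 by rewrite mulr1 add0r.
have V10 : 1 + (b + 1) * 0 = 1 by rewrite mulr0 addr0.
have b10 : b + 1 != 0 by rewrite addx_eq0.
(* In this case the line of slope [s] through the origin has no other affine arc point, so its
   second arc point is at infinity. *)
have [pr|pr] := boolP (~~ trb s && ~~ trb (b ^+ 2 * s)).
  have [/negbTE p0 /negbTE r0] := andP pr.
  have no_u u : affine_arc b u (s * u) -> u = 0.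
    rewrite (arc_bits _ _ _ _ erefl erefl) => /eqP.
    case E0 : (trb (s * u)); case E1 : (trb (b * (s * u))); rewrite ?V11 ?V01 ?V10.
    + by move=> ub; rewrite ub bsb r0 in E1.
    + by move=> u1; rewrite u1 mulr1 p0 in E0.
    + by move=> ub1; move: E0 E1; rewrite ub1 sb1 bsb1 p0 r0; case: (trb _).
    + by rewrite mulr0 addr0.
  have : (0 < #|A :&: points_on (slant g' s 0%R) :\ aff g' 0%R (s * 0)%R|)%N.
    have := sec s 0; have := in_slant 0 arc00; rewrite (cardsD1 (aff g' 0 (s * 0))).
    by move=> ->; case: #|_|.
  rewrite card_gt0 => /set0Pn[Q]; rewrite in_setD1 in_setI => /and3P[].
  case: (frameP ug' Q) => [u v|d'|] ne AQ; last by rewrite (vtx_on_slant ug').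
    rewrite (aff_on_slant ug') addr0 => /eqP vE; move: ne AQ; rewrite {}vE arcA.
    by move=> ne /no_u u0; rewrite u0 eqxx in ne.
  by rewrite (inf_on_slant ug') => /eqP <-.
apply/negbTE/negP => infA.
(* In every other case one of [1], [b], [b + 1] is the abscissa of a second affine arc point, which
   leaves no room for [inf g' s]. *)
have [u u0 arc_u] : exists2 u, u != 0 & affine_arc b u (s * u).
  move: pr; case Ep : (trb s); case Eq : (trb (b * s)); case Er : (trb (b ^+ 2 * s)) => // _.
  - by exists b => //; rewrite (arc_bits _ _ true true) ?V11 ?bsb // mulrC.
  - by exists (b + 1) => //; rewrite (arc_bits _ _ false true) ?V01 // ?sb1 ?bsb1 ?Ep ?Eq ?Er.
  - by exists 1; rewrite ?oner_eq0 // mulr1 (arc_bits _ _ true false) ?V10.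
  - by exists 1; rewrite ?oner_eq0 // mulr1 (arc_bits _ _ true false) ?V10.
  - by exists b => //; rewrite (arc_bits _ _ true true) ?V11 ?bsb // mulrC.
  - by exists (b + 1) => //; rewrite (arc_bits _ _ false true) ?V01 // ?sb1 ?bsb1 ?Ep ?Eq ?Er.
have inf_in : inf g' s \in A :&: points_on (slant g' s 0).
  by rewrite in_setI infA (inf_on_slant ug') eqxx.
have ne w z : inf g' s != aff g' w z.
  by apply: contraFneq (aff_on_linf ug' w z) => <-; rewrite (inf_on_linf ug').
have : (2 < #|A :&: points_on (slant g' s 0%R)|)%N.
  apply: card_ge3 inf_in (in_slant _ arc00) (in_slant _ arc_u) _ _ _; rewrite ?ne //.
  by rewrite (aff_eq ug') eq_sym (negbTE u0).
by have := sec s 0; rewrite !inE => /orP[] /eqP->.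
Qed.

End Classification.

(** * The arcs of the family: equivalence and translations *)

Section Family.
Variables (F : finFieldType) (h : nat).
Hypothesis cardF : #|F| = (2 ^ h)%N.
Let ch2 : 2 \in [pchar F] := card_finPcharP cardF isT.
Implicit Types (P Q R : point F) (l m : line F) (g : 'M[F]_3).
Local Notation u1 := (unitmx1 F 3).

Lemma mem_trace_points P x y p q c d : nz3 x y 0 ->
  (P \in trace_points x y p q c d) =
  [exists z, [&& P == fpt 1%:M x y z, Tr (z / p) == ofF2 F c & Tr (z / q) == ofF2 F d]].
Proof.
move=> xy; rewrite inE; apply: eq_existsb => z; rewrite val_pt_eq /fpt ?mulmx1 //.
by rewrite vec3_eq0; apply: contra xy => /and3P[-> -> _]; rewrite eqxx.
Qed.

Lemma aff_trace_points1 u v y p q c d :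
  (aff 1%:M u v \in trace_points 1 y p q c d) =
  [&& u == y, Tr (v / p) == ofF2 F c & Tr (v / q) == ofF2 F d].
Proof.
rewrite mem_trace_points /nz3 ?oner_eq0 //; apply/existsP/and3P.
  case=> z; have -> : fpt 1%:M 1 y z = aff 1%:M y z by rewrite aff.unlock.
  by rewrite (aff_eq u1) => /and3P[/andP[-> /eqP->] -> ->].
case=> /eqP-> Tp Tq; exists v; rewrite Tp Tq.
by rewrite aff.unlock !eqxx.
Qed.

Lemma inf_trace_points0 s p q c d :
  (inf 1%:M s \in trace_points 0 1 p q c d) =
  (Tr (s / p) == ofF2 F c) && (Tr (s / q) == ofF2 F d).
Proof.
rewrite mem_trace_points /nz3 ?oner_eq0 ?andbF //; apply/existsP/andP.
  case=> z; have -> : fpt 1%:M 0 1 z = inf 1%:M z by rewrite inf.unlock.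
  by rewrite (inf_eq u1) => /and3P[/eqP-> -> ->].
case=> Tp Tq; exists s; rewrite Tp Tq.
by rewrite inf.unlock !eqxx.
Qed.

Lemma trace_points1_off P y p q c d :
  P \in points_on (linf 1%:M) -> (P \in trace_points 1 y p q c d) = false.
Proof.
move=> lP; rewrite mem_trace_points /nz3 ?oner_eq0 //; apply/existsP => -[z].
have -> : fpt 1%:M 1 y z = aff 1%:M y z by rewrite aff.unlock.
by case/and3P=> /eqP PE _ _; rewrite PE (aff_on_linf u1) in lP.
Qed.

Lemma trace_points0_on P p q c d :
  P \in trace_points 0 1 p q c d -> exists z, P = inf 1%:M z.
Proof.
rewrite mem_trace_points /nz3 ?oner_eq0 ?andbF // => /existsP[z /and3P[/eqP-> _ _]].
by exists z; rewrite inf.unlock.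
Qed.

Lemma vtx_neq_inf g s : g \in unitmx -> vtx g != inf g s.
Proof.
move=> ug; apply: contraFneq (inf_on_vert ug s 0) => <-.
by rewrite (vtx_on_vert ug).
Qed.

Section Membership.
Variable b : F.
Hypotheses (b0 : b != 0) (b1 : b != 1).
Local Notation T := (km_arc_family (1 / b ^+ 2) b 0 0).

Let gammaE : (b + 1) / (1 / b ^+ 2 * b + 1) = b.
Proof.
have b10 : b + 1 != 0 by rewrite addx_eq0.
have -> : 1 / b ^+ 2 * b + 1 = (b + 1) / b by field.
by field; rewrite b0.
Qed.

Let ofF2_0 : ofF2 F 0 = 0. Proof. by []. Qed.
Let ofF2_1 : ofF2 F 1 = 1. Proof. by []. Qed.

(** For [alpha = 1 / b^2] the parameters collapse: [gamma = b], hence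
    [alpha beta = alpha gamma = 1 / b] and [xi = 1]. *)
Lemma family_def : T = trace_points 0 1 1 (1 / b ^+ 2) 0 0
  :|: trace_points 1 0 1 (1 / b) 0 0 :|: trace_points 1 1 1 (1 / b) 1 0
  :|: trace_points 1 b (1 / b) 1 1 1 :|: trace_points 1 (b + 1) (1 / b) 1 1 0.
Proof.
rewrite /km_arc_family gammaE.
have -> : 1 / b ^+ 2 * b = 1 / b by field.
by rewrite divfK // !add0r.
Qed.

(** The four affine pieces, at [u = 0, 1, b, b + 1], correspond to the four values of the pair
    [Tr v], [Tr (b v)]. *)
Lemma aff_family u v : (aff 1%:M u v \in T) = affine_arc b u v.
Proof.
have off0 : (aff 1%:M u v \in trace_points 0 1 1 (1 / b ^+ 2) 0 0) = false.
  apply/negP => /trace_points0_on[z e]; have := aff_on_linf u1 u v.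
  by rewrite e (inf_on_linf u1).
rewrite family_def !in_setU off0 !aff_trace_points1 !divr1 div1r invrK.
rewrite (mulrC v) /affine_arc ofF2_0 ofF2_1.
have V11 : 1 + (b + 1) * 1 = b by rewrite mulr1 addrC addxK.
have z01 : (0 == 1 :> F) = false by rewrite eq_sym oner_eq0.
by case/orP: (Tr01 cardF v) => /eqP->; case/orP: (Tr01 cardF (b * v)) => /eqP->;
  rewrite ?V11 ?mulr0 ?mulr1 ?addr0 ?add0r ?eqxx ?oner_eq0 ?z01 ?andbF ?andbT ?orbF.
Qed.

Lemma inf_family s : (inf 1%:M s \in T) = ~~ trb s && ~~ trb (b ^+ 2 * s).
Proof.
rewrite family_def !in_setU !trace_points1_off ?(inf_on_linf u1) //.
rewrite !orbF inf_trace_points0 !divr1 div1r invrK (mulrC s) ofF2_0.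
by rewrite /trb !negbK.
Qed.

Lemma vtx_family : vtx 1%:M \notin T.
Proof.
rewrite family_def !in_setU !trace_points1_off ?(vtx_on_linf u1) // !orbF.
apply/negP => /trace_points0_on[z e]; have := vtx_neq_inf z u1.
by rewrite e eqxx.
Qed.

End Membership.

(** The inverse of [g] carries the frame [g] to the standard one, in which the arc of the family has
    the same description. *)
Lemma normal_frame_equivalent (A : {set point F}) g b : normal_frame A g b ->
  PGL3_equivalent A (km_arc_family (1 / b ^+ 2) b 0 0).
Proof.
case=> -[ug b0 b1] [affA vtxA infA].
have uV : invmx g \in unitmx by rewrite unitmx_inv.
have [s sPGL sE] := perm_of_mx uV.
have sfpt x y z : nz3 x y z -> s (fpt g x y z) = fpt 1%:M x y z.
  move=> nz; rewrite /fpt sE; first by rewrite mulmxK // mulmx1.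
  by rewrite mulg_eq0 // vec3_eq0.
exists s => //; apply/setP => Q; rewrite -(permKV s Q) mem_imset; last exact: perm_inj.
case: (frameP ug (s^-1%g Q)) => [x z|d|].
- rewrite affA -(aff_family b0 b1).
  suff -> : s (aff g x z) = aff 1%:M x z by [].
  by rewrite !aff.unlock sfpt // /nz3 oner_eq0.
- rewrite infA -(inf_family b0 b1).
  suff -> : s (inf g d) = inf 1%:M d by [].
  by rewrite !inf.unlock sfpt // /nz3 oner_eq0 andbF.
- rewrite (negbTE vtxA); apply/esym/negbTE.
  have -> : s (vtx g) = vtx 1%:M by rewrite !vtx.unlock sfpt // /nz3 oner_eq0 !andbF.
  exact: (vtx_family b0 b1).
Qed.

Lemma mx_collineation (M : 'M[F]_3) (s : {perm point F}) : M \in unitmx ->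
  (forall u, u != 0 -> s (pt u) = pt (u *m M)) -> collineation s.
Proof.
move=> uM sE; apply/forallP => l; have [v v0 ->] := ln_surj l.
have uV : invmx M \in unitmx by rewrite unitmx_inv.
have Mv0 : invmx M *m v != 0 by rewrite gmul_eq0.
apply/existsP; exists (ln (invmx M *m v)); apply/eqP/setP => Q.
rewrite -(permKV s Q) mem_imset; last exact: perm_inj.
have [u u0 ->] := pt_surj (s^-1%g Q).
by rewrite sE // !on_ln ?mulg_eq0 // mulmxA mulmxK.
Qed.

Lemma translation_elation g du dv : g \in unitmx ->
  exists2 s : {perm point F}, [exists R, elation (linf g) R s] &
    forall x z, s (aff g x z) = aff g (x + du) (z + dv).
Proof.
move=> ug; pose n := rows3 (vec3 1 du dv) (vec3 0 1 0) (vec3 0 0 1).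
have nE x y z : vec3 x y z *m n = vec3 x (y + x * du) (z + x * dv).
  rewrite vec3_rows3 !vec3Z; apply/rowP => j; rewrite !mxE.
  by case: j => -[|[|[|//]]] lt_j /=; ring.
have un : n \in unitmx.
  rewrite -row_free_unit; apply: inj_row_free => u.
  rewrite (vec3E u) nE => /eqP; rewrite vec3_eq0 => /and3P[/eqP-> + +].
  by rewrite !mul0r !addr0 => /eqP-> /eqP->; apply/eqP; rewrite vec3_eq0 !eqxx.
pose M := invmx g *m n *m g.
have uM : M \in unitmx by rewrite !unitmx_mul unitmx_inv un ug.
have [s _ sE] := perm_of_mx uM.
have sfpt x y z : nz3 x y z -> s (fpt g x y z) = fpt g x (y + x * du) (z + x * dv).
  move=> nz; rewrite /fpt sE; last by rewrite mulg_eq0 // vec3_eq0.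
  by rewrite /M !mulmxA mulmxK // nE.
have saff x z : s (aff g x z) = aff g (x + du) (z + dv).
  by rewrite aff.unlock sfpt ?mul1r // /nz3 oner_eq0.
have sinf d : s (inf g d) = inf g d.
  by rewrite inf.unlock sfpt ?mul0r ?addr0 // /nz3 oner_eq0 andbF.
have svtx : s (vtx g) = vtx g.
  by rewrite vtx.unlock sfpt ?mul0r ?addr0 // /nz3 oner_eq0 !andbF.
exists s => //; apply/existsP.
(* The centre is the point at infinity in the direction of the translation; the identity admits any
   centre. *)
pose R := if (du == 0) && (dv == 0) then vtx g else fpt g 0 du dv.
have nzR : ~~ ((du == 0) && (dv == 0)) -> nz3 0 du dv by rewrite /nz3 eqxx.
exists R; apply/and4P; split.
- rewrite /R; case: ifPn => [_|/nzR nz]; first by rewrite (vtx_on_linf ug).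
  by rewrite linf.unlock on_fln ?/nz3 ?oner_eq0 // !mulr0 !addr0 mul0r.
- exact: mx_collineation uM sE.
- apply/forallP => P; apply/implyP.
  by case: (frameP ug P) => [x z|d|]; rewrite ?(aff_on_linf ug) // ?sinf ?svtx.
apply/forallP => m; apply/implyP => mR; rewrite eqEcard card_imset ?leqnn ?andbT; last first.
  exact: perm_inj.
apply/subsetP => _ /imsetP[P mP ->]; have [a [b [c [nz mE]]]] := fln_surj ug m.
have dR : du * b + dv * c = 0.
  move: mR; rewrite /R mE; case: ifPn => [/andP[/eqP-> /eqP->] _|/nzR nzR'].
    by rewrite !mul0r addr0.
  by rewrite on_fln // mul0r add0r => /eqP.
case: (frameP ug P) mP => [x z|d|] mP; rewrite ?saff ?sinf ?svtx //.
have nz1 x' z' : nz3 1 x' z' by rewrite /nz3 oner_eq0.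
move: mP; rewrite mE aff.unlock !on_fln // => /eqP e.
suff -> : 1 * a + (x + du) * b + (z + dv) * c = 0 by [].
by rewrite -e -[RHS]addr0 -dR; ring.
Qed.

(** The affine part is the graph of an additive function, hence is stable under translation by the
    sum of two of its points, which in characteristic 2 is also their difference. *)
Lemma normal_frame_translation (A : {set point F}) g b : normal_frame A g b ->
  {in A :\: points_on (linf g) &, forall P Q,
     exists2 s, s \in elations_stab (linf g) A & s P = Q}.
Proof.
case=> -[ug b0 b1] [affA vtxA infA] P Q.
rewrite !in_setD => /andP[+ AP] /andP[+ AQ].
case: (frameP ug P) AP => [x z|d|]; rewrite ?(inf_on_linf ug) ?(vtx_on_linf ug) //.
case: (frameP ug Q) AQ => [x' z'|d|]; rewrite ?(inf_on_linf ug) ?(vtx_on_linf ug) //.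
rewrite !affA => arc' arc _ _.
have [s elS sE] := translation_elation (x + x') (z + z') ug.
exists s; last by rewrite sE !addKx.
rewrite inE elS eqEcard card_imset ?leqnn ?andbT; last exact: perm_inj.
apply/subsetP => _ /imsetP[R AR ->].
have sfix R' : R' \in points_on (linf g) -> s R' = R'.
  by case/existsP: elS => C elC; exact: elation_fix elC.
case: (frameP ug R) AR => [x2 z2|d|] AR.
- move: arc' arc AR; rewrite sE !affA /affine_arc => /eqP-> /eqP-> /eqP->.
  by rewrite !mulrDr !(TrD cardF); apply/eqP; ring.
- by rewrite sfix ?(inf_on_linf ug).
- by rewrite sfix ?(vtx_on_linf ug).
Qed.

End Family.

Theorem theorem3p12 (F : finFieldType) (h : nat)
    (cardF : #|F| = (2 ^ h)%N) (q_ge8 : (8 <= #|F|)%N)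
    (A : {set point F}) (arcA : elation_km_arc (#|F| %/ 4) A) :
  (exists beta : F,
     [/\ beta != 0, beta != 1
       & PGL3_equivalent A (km_arc_family (1 / beta ^+ 2) beta 0 0)]) /\
  translation_km_arc (#|F| %/ 4) A.
Proof.
have [g0 [H [frame0 kmA]]] := arc_frame_exists cardF q_ge8 arcA.
have [g [b frame]] := normal_frame_exists cardF frame0.
split; last by exists (linf g); split; last exact: (normal_frame_translation cardF frame).
exists b; have [[_ b0 b1] _] := frame; split=> //.
exact: (normal_frame_equivalent cardF frame).
Qed.
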